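(* Let $m_1,m_2\ge 1$, $n_1\ge m_1$, $n_2\ge m_2$ be integers. Let $X_1,\ldots,X_{n_1}$ be i.i.d. with law $P$ on a measurable space $\mathcal{X}$ and, independently, let $Y_1,\ldots,Y_{n_2}$ be i.i.d. with law $Q$ on a measurable space $\mathcal{Y}$. Let $h:\mathcal{X}^{m_1}\times\mathcal{Y}^{m_2}\to\mathbb{R}$ be measurable with $Z:=h(X_1,\ldots,X_{m_1};Y_1,\ldots,Y_{m_2})$ integrable, let $m_h=\mathrm{E}\,Z$, and let $U=U_{n_1,n_2}(h)$ be the two-sample U-statistic with kernel $h$. Let $k=\min(\lfloor n_1/m_1\rfloor,\lfloor n_2/m_2\rfloor)$ and let $\bar Z_k$ be the average of $k$ i.i.d. copies of $Z$. Then for every convex $\Phi:\mathbb{R}\to\mathbb{R}$, $$\mathrm{E}\,\Phi(U-m_h)\le\mathrm{E}\,\Phi(\bar Z_k-m_h)$$ (expectations may be $+\infty$). Consequently, the following hold. (1) If $h$ takes values in an interval of length $R>0$, then for all $t>0$, $\mathbb{P}(U-m_h\ge t)\le\exp(-2kt^2/R^2)$ and $\mathbb{P}(|U-m_h|\ge t)\le 2\exp(-2kt^2/R^2)$; and for every $\delta\in(0,1)$, with probability at least $1-\delta$, $|U-m_h|\le R\sqrt{\frac{\log(2/\delta)}{2k}}$. (2) Let $\sigma^2=\mathrm{Var}(Z)$ and suppose $b=\|h-m_h\|_\infty<\infty$. Then for all $t>0$, $$\mathbb{P}(U-m_h\ge t)\le\exp\left(-\frac{k\sigma^2}{b^2}\,\varphi\!\left(\frac{bt}{\sigma^2}\right)\right),\qquad\varphi(u)=(1+u)\log(1+u)-u$$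 (right-hand side read as $0$ if $\sigma^2=0$), and $$\mathbb{P}(|U-m_h|\ge t)\le 2\exp\left(-\frac{kt^2}{2(\sigma^2+bt/3)}\right)$$ (right-hand side read as $0$ if $\sigma^2=b=0$); and for every $\delta\in(0,1)$, with probability at least $1-\delta$, $$|U-m_h|\le\sqrt{\frac{2\sigma^2\log(2/\delta)}{k}}+\frac{2b\log(2/\delta)}{3k}.$$ (3) If $Z$ is sub-Gaussian with variance proxy $\nu^2$, $\nu>0$, then for all $t>0$, $\mathbb{P}(|U-m_h|\ge t)\le 2\exp\left(-\frac{kt^2}{2\nu^2}\right)$; and for every $\delta\in(0,1)$, with probability at least $1-\delta$, $|U-m_h|\le\nu\sqrt{\frac{2\log(2/\delta)}{k}}$. (4) If $Z$ is sub-exponential with parameters $(\nu^2,\alpha)$, $\nu>0$, $\alpha>0$, then for all $t>0$, $\mathbb{P}(|U-m_h|\ge t)\le 2\exp\left(-\frac k2\min\left\{\frac{t^2}{\nu^2},\frac t\alpha\right\}\right)$; and for every $\delta\in(0,1)$, with probability at least $1-\delta$, $|U-m_h|\le\nu\sqrt{\frac{2\log(2/\delta)}{k}}+\frac{2\alpha\log(2/\delta)}{k}$.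
   Context: The two-sample U-statistic is $$U_{n_1,n_2}(h)=\frac{1}{\binom{n_1}{m_1}\binom{n_2}{m_2}}\sum_{(i_1,\ldots,i_{m_1})}\ \sum_{(j_1,\ldots,j_{m_2})}h(X_{i_1},\ldots,X_{i_{m_1}};Y_{j_1},\ldots,Y_{j_{m_2}}),$$ the sums extending over increasing tuples $1\le i_1<\cdots<i_{m_1}\le n_1$ and $1\le j_1<\cdots<j_{m_2}\le n_2$. No symmetry of $h$ is assumed. $\|\cdot\|_\infty$ denotes the supremum norm over $\mathcal{X}^{m_1}\times\mathcal{Y}^{m_2}$. $\mathbb{P}$ denotes probability. A real random variable $Z$ with mean $\mu$ is sub-Gaussian with variance proxy $\nu^2$ if $\mathrm{E}\,e^{\lambda(Z-\mu)}\le e^{\lambda^2\nu^2/2}$ for all $\lambda\in\mathbb{R}$, and sub-exponential with parameters $(\nu^2,\alpha)$, $\alpha>0$, if the same bound holds for all $|\lambda|\le 1/\alpha$. *)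

(* Defs.v *)
From mathcomp Require Export all_boot all_order all_algebra.
From mathcomp Require Export all_classical all_reals all_analysis.

Set Implicit Arguments.
Unset Strict Implicit.
Unset Printing Implicit Defensive.

Export Order.TTheory GRing.Theory Num.Theory.
Export numFieldNormedType.Exports.
Local Open Scope classical_set_scope.
Local Open Scope ring_scope.

Section independence.
Context {d d1 d2 : measure_display} {O : measurableType d}
  {T1 : measurableType d1} {T2 : measurableType d2} {R : realType}.
Variable P : probability O R.

Definition mutually_independent (I : finType) (X : I -> {RV P >-> T1}) : Prop :=
  forall (J : {set I}) (A : I -> set T1), (forall i, measurable (A i)) ->
    P [set w | forall i, i \in J -> A i (X i w)] =
    (\prod_(i in J) fine (P (X i @^-1` A i)))%:E.

Definition independent_pair (V : O -> T1) (W : O -> T2) : Prop :=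
  forall (A : set T1) (B : set T2), measurable A -> measurable B ->
    P (V @^-1` A `&` W @^-1` B) = (P (V @^-1` A) * P (W @^-1` B))%E.

(* Only the values of [law] on measurable sets matter, so that the law of a
   random element given as a bare function can be passed as a [pushforward]. *)
Definition iid_with_law (I : finType) (X : I -> {RV P >-> T1})
    (law : set T1 -> \bar R) : Prop :=
  mutually_independent X /\
  forall i (A : set T1), measurable A -> distribution P (X i) A = law A.

Definition sample (n : nat) (X : 'I_n -> {RV P >-> T1}) (w : O) : n.-tuple T1 :=
  [tuple X i w | i < n].

End independence.
Arguments mutually_independent {d d1 O T1 R} P {I} X.
Arguments iid_with_law {d d1 O T1 R} P {I} X law.

(* Indices start at 0: i ranges over the strictly increasing m1-tuples of
   elements of {0, ..., n1 - 1}, and likewise for j. *)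
Definition two_sample_U (R : realType) (TX TY : Type) (m1 m2 n1 n2 : nat)
    (h : m1.-tuple TX * m2.-tuple TY -> R)
    (x : n1.-tuple TX) (y : n2.-tuple TY) : R :=
  ('C(n1, m1)%:R * 'C(n2, m2)%:R)^-1 *
  \sum_(i : m1.-tuple 'I_n1 | sorted ltn (map val i))
    \sum_(j : m2.-tuple 'I_n2 | sorted ltn (map val j))
      h ([tuple tnth x (tnth i a) | a < m1], [tuple tnth y (tnth j c) | c < m2]).

Definition sup_norm (R : realType) (T : Type) (f : T -> R) : \bar R :=
  ereal_sup (range (fun z => `|f z|%:E)).

Section tails.
Context {d : measure_display} {O : measurableType d} {R : realType}.
Variable P : probability O R.

(* [v] is the variance proxy itself (the square of the usual scale). Both
   notions are meant for integrable Z, so that [fine 'E_P[Z]] is its mean. *)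
Definition sub_gaussian (Z : O -> R) (v : R) : Prop :=
  forall l : R,
    ('M_P (Z \- cst (fine 'E_P[Z]))%R l <= (expR (l ^+ 2 * v / 2))%:E)%E.

Definition sub_exponential (Z : O -> R) (v alpha : R) : Prop :=
  forall l : R, `|l| <= alpha^-1 ->
    ('M_P (Z \- cst (fine 'E_P[Z]))%R l <= (expR (l ^+ 2 * v / 2))%:E)%E.

End tails.

Definition bennett (R : realType) (u : R) : R := (1 + u) * ln (1 + u) - u.

(* Main.v *)
From mathcomp Require Import fingroup perm action alt primitive_action.
From mathcomp Require Import measurable_realfun ring lra.
Require Import Defs.

(** The argument is Hoeffding's. Fix [k] disjoint blocks of [m1] indices in the
    first sample and [k] disjoint blocks of [m2] indices in the second. For a
    pair [p] of permutations of the two index sets, apply [p] to the blocks and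
    put every block back into increasing order. The kernel evaluated at the
    [k] resulting pairs of increasing tuples uses disjoint sets of variables,
    so the [k] values are i.i.d. copies of [Z]; let [W p] be their average. When
    [p] ranges over all pairs of permutations, each sorted block runs over the
    increasing tuples of its length and hits all of them equally often, because
    the symmetric group acts transitively on tuples of distinct points. Hence
    the U-statistic is the uniform average of the [W p]
    ([two_sample_U_average]). Sorting the blocks is what makes this true
    without any symmetry of the kernel.

    The convex domination follows by Jensen's inequality over [p], since every
    [W p] has the law of the average of [k] i.i.d. copies of [Z]
    ([U_convex_domination]). That law is determined by the product rule on
    boxes, through the uniqueness of finite measures on a generating pi-system
    ([iid_as_generated], [iid_as_law_unique]). Expectations may be infinite:
    a convex function is bounded below by an affine one, so each integral is
    either finite or [+oo] ([bounded_below_integrable]).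

    Applied to [exp], and combined with the multiplicativity of expectation
    over independent variables ([integral_prod_iid_as_le]), the domination
    turns a bound [exp g] on the moment generating function of [Z - m_h] at [l]
    into the bound [exp (k g)] on that of [U - m_h] at [k l]
    ([U_mgf_transfer]). All four tail bounds are then Chernoff's method, with
    Hoeffding's lemma ([hoeffding_mgf]) when only the range is known and the
    comparison of [e^x - 1 - x] with [x^2] ([bennett_mgf], [bernstein_mgf])
    when the variance enters; the confidence statements solve the tail bounds for
    the level [delta]. *)

Set Implicit Arguments.
Unset Strict Implicit.
Unset Printing Implicit Defensive.
Local Open Scope ring_scope.

(** * Sorted images of a block under permutations *)

Section arrange.
Variables (n m : nat).
Implicit Types (s : {perm 'I_n}) (b t : m.-tuple 'I_n).

Definition arrange s b : m.-tuple 'I_n :=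
  sort_tuple (relpre val leq) (map_tuple s b).

Lemma perm_arrange s b : perm_eq (arrange s b) (map s b).
Proof. exact/permPl/perm_sort. Qed.

Lemma arrange_uniq s b : uniq b -> uniq (arrange s b).
Proof.
by move=> ub; rewrite (perm_uniq (perm_arrange s b)) map_inj_uniq//; exact: perm_inj.
Qed.

Lemma arrange_increasing s b : uniq b -> sorted ltn (map val (arrange s b)).
Proof.
move=> ub; rewrite ltn_sorted_uniq_leq map_inj_uniq ?arrange_uniq//=; last exact: val_inj.
by rewrite -sort_map; apply: sort_sorted; exact: leq_total.
Qed.

Lemma arrange_eq s b t : sorted ltn (map val t) ->
  (arrange s b == t) = perm_eq (map s b) t.
Proof.
move=> st; apply/eqP/idP => [<-|bt]; first by rewrite perm_sym perm_arrange.
apply/val_inj/(inj_map val_inj)/(irr_sorted_eq ltn_trans ltnn) => //.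
  apply: arrange_increasing.
  have := perm_uniq bt; rewrite map_inj_uniq; last exact: perm_inj.
  move=> ->; rewrite -(map_inj_uniq val_inj).
  by move: st; rewrite ltn_sorted_uniq_leq => /andP[].
by move=> x; apply/perm_mem/perm_map; rewrite (perm_trans (perm_arrange s b)).
Qed.

(** A permutation [p] that carries [t] to [t'], which exists by transitivity,
    maps the permutations that arrange [b] into [t] injectively to those that
    arrange it into [t'], by [s |-> s * p]. *)
Lemma card_arrange_le b t t' :
  sorted ltn (map val t) -> sorted ltn (map val t') ->
  (#|[set s | arrange s b == t]| <= #|[set s | arrange s b == t']|)%N.
Proof.
move=> st st'.
have uniq_incr (u : m.-tuple 'I_n) : sorted ltn (map val u) -> uniq u.
  by rewrite -(map_inj_uniq val_inj) ltn_sorted_uniq_leq => /andP[].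
have mem_dtuple (u : m.-tuple 'I_n) : sorted ltn (map val u) ->
    u \in dtuple_on m [set: 'I_n]%SET.
  move=> su; apply/dtuple_onP; split=> [|i]; last by rewrite finset.in_setT.
  exact/tuple_uniqP/uniq_incr.
have mn : (m <= #|'I_n|)%N.
  by rewrite -[m](size_tuple t) -(card_uniqP (uniq_incr _ st)) max_card.
have : t' \in action.orbit ('P * m)%act ('Sym_('I_n))%G t.
  by rewrite (atransP (ntransitive_weak mn (Sym_trans 'I_n))) mem_dtuple.
case/action.orbitP=> p _ pt.
have pt' : t' = map_tuple p t by rewrite -pt; apply: val_inj.
rewrite -(card_imset _ (@mulIg _ p)); apply: subset_leq_card.
apply/fintype.subsetP => _ /imsetP[s + ->]; rewrite !inE !arrange_eq// => bt.
rewrite pt' (eq_map (permM s p)) (map_comp p s) /=.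
exact: perm_map.
Qed.

(** All the fibres of [arrange ^~ b] over the increasing tuples have the same
    cardinality [c], so the two averages only differ by the normalization, and
    [n! = c * 'C(n, m)] is the case of the constant function. *)
Lemma average_arrange (R : numFieldType) (F : m.-tuple 'I_n -> R) b :
  (m <= n)%N -> uniq b ->
  (n`!%:R)^-1 * \sum_(s : {perm 'I_n}) F (arrange s b) =
  ('C(n, m)%:R)^-1 * \sum_(t : m.-tuple 'I_n | sorted ltn (map val t)) F t.
Proof.
move=> mn ub.
pose t0 := arrange 1%g b.
have st0 : sorted ltn (map val t0) by exact: arrange_increasing.
pose c := #|[set s | arrange s b == t0]|.
have count_c t : sorted ltn (map val t) -> #|[set s | arrange s b == t]| = c.
  by move=> st; apply/eqP; rewrite eqn_leq !card_arrange_le.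
have sumE (G : m.-tuple 'I_n -> R) : \sum_(s : {perm 'I_n}) G (arrange s b) =
    c%:R * \sum_(t : m.-tuple 'I_n | sorted ltn (map val t)) G t.
  rewrite (partition_big (fun s => arrange s b) (fun t => sorted ltn (map val t))) /=;
    last by move=> s _; exact: arrange_increasing.
  rewrite mulr_sumr; apply: eq_bigr => t st.
  rewrite (eq_bigr (fun=> G t)) => [|s /eqP -> //].
  by rewrite sumr_const -(count_c _ st) cardsE mulr_natl.
have cE : (n`!%:R : R) = c%:R * 'C(n, m)%:R.
  rewrite -(card_ltn_sorted_tuples m n) cardsE -sum1_card natr_sum.
  rewrite -(sumE (fun=> 1)) sumr_const.
  by rewrite -(card_Sn n).
have c0 : c%:R != 0 :> R.
  by apply: contra_eq_neq cE => ->; rewrite mul0r pnatr_eq0 -lt0n fact_gt0.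
rewrite sumE mulrA cE invfM; congr (_ * _).
by rewrite mulrAC mulVf// mul1r.
Qed.

End arrange.

(** * The U-statistic as an average over permutations *)

Section blocks.
Variables (n m k : nat) (km_le_n : (k * m <= n)%N).

(** The indices of a [k * m] matrix, enumerated row by row: row [j] is the
    block, and distinct entries have distinct indices. *)
Definition block (j : 'I_k) : m.-tuple 'I_n :=
  [tuple widen_ord km_le_n (mxvec_index j a) | a < m].

Lemma block_uniq j : uniq (block j).
Proof.
apply/tuple_uniqP => a c; rewrite !tnth_mktuple => /(congr1 val)/=.
by move=> /val_inj/enum_rank_inj[].
Qed.

Lemma mem_block j x : x \in block j -> exists a, x = widen_ord km_le_n (mxvec_index j a).
Proof. by case/tnthP => a ->; exists a; rewrite tnth_mktuple. Qed.

(** Two entries of arranged blocks are images under the same permutation of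
    entries of the blocks, and blocks are disjoint; inside one block, arranging
    keeps the entries distinct. *)
Lemma arranged_blocks_inj (s : {perm 'I_n}) :
  injective (fun p : 'I_k * 'I_m => tnth (arrange s (block p.1)) p.2).
Proof.
move=> [i a] [j c] /= eq_ac.
have mem_arr l d : exists e,
    tnth (arrange s (block l)) d = s (widen_ord km_le_n (mxvec_index l e)).
  have := mem_tnth d (arrange s (block l)).
  rewrite (perm_mem (perm_arrange _ _)) => /mapP[y /mem_block[e ->] ->].
  by exists e.
have ij : i = j.
  have [e ae] := mem_arr i a; have [f cf] := mem_arr j c.
  move: eq_ac; rewrite ae cf => /perm_inj/(congr1 val)/=.
  by move=> /val_inj/enum_rank_inj[].
rewrite -{j}ij in eq_ac *; congr (_, _).
exact: (tuple_uniqP _ (arrange_uniq s (block_uniq i))).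
Qed.

End blocks.

(** For each [j] alone, the average over the permutations is already the
    U-statistic; the average over [j] is there to make the inner sum a mean of
    independent terms once the permutations are fixed. *)
Lemma two_sample_U_average (R : realType) (TX TY : Type) (m1 m2 n1 n2 k : nat)
    (k1 : (k * m1 <= n1)%N) (k2 : (k * m2 <= n2)%N)
    (h : m1.-tuple TX * m2.-tuple TY -> R)
    (x : n1.-tuple TX) (y : n2.-tuple TY) :
  (0 < k)%N ->
  two_sample_U h x y =
  (#|{: {perm 'I_n1} * {perm 'I_n2}}|%:R)^-1 *
  \sum_(p : {perm 'I_n1} * {perm 'I_n2})
    k%:R^-1 * \sum_(j < k)
      h ([tuple tnth x (tnth (arrange p.1 (block k1 j)) a) | a < m1],
         [tuple tnth y (tnth (arrange p.2 (block k2 j)) c) | c < m2]).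
Proof.
move=> k0.
have m1n1 : (m1 <= n1)%N by rewrite (leq_trans _ k1)// leq_pmull.
have m2n2 : (m2 <= n2)%N by rewrite (leq_trans _ k2)// leq_pmull.
pose G (t : m1.-tuple 'I_n1) (u : m2.-tuple 'I_n2) :=
  h ([tuple tnth x (tnth t a) | a < m1], [tuple tnth y (tnth u c) | c < m2]).
have avg_block (j : 'I_k) :
    n1`!%:R^-1 * n2`!%:R^-1 * \sum_(p : {perm 'I_n1} * {perm 'I_n2})
      G (arrange p.1 (block k1 j)) (arrange p.2 (block k2 j)) =
    two_sample_U h x y.
  rewrite -(pair_bigA _ (fun s t =>
    G (arrange s (block k1 j)) (arrange t (block k2 j))))/= -mulrA mulr_sumr.
  under eq_bigr do rewrite average_arrange ?block_uniq//.
  rewrite (average_arrange (fun t => _ * \sum_(u | _) G t u)) ?block_uniq//.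
  by rewrite -mulr_sumr mulrA /two_sample_U invfM.
have card_perms n : #|{perm 'I_n}| = n`! by exact: card_Sn.
rewrite card_prod !card_perms natrM invfM -mulr_sumr mulrCA exchange_big/=.
rewrite mulr_sumr.
under eq_bigr do rewrite avg_block.
rewrite sumr_const card_ord -(mulr_natl (two_sample_U _ _ _)).
rewrite mulrA mulVf ?mul1r//.
by rewrite pnatr_eq0 -lt0n.
Qed.

Local Open Scope classical_set_scope.

(** * The product rule and generating pi-systems *)

Section iid_as.
Context {d dS : measure_display} {O : measurableType d}
  {S : measurableType dS} {R : realType}.

(** Independence and identical distribution in one formula: taking all the
    sets but one full gives the marginals. The index set is an arbitrary finite
    type so that families indexed by pairs (block, position) fit. *)
Definition iid_as (P : probability O R) (mu : set S -> \bar R)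
    (I : finType) (V : I -> O -> S) : Prop :=
  forall A : I -> set S, (forall i, measurable (A i)) ->
    P [set w | forall i, A i (V i w)] = (\prod_i fine (mu (A i)))%:E.

Variable P : probability O R.

Lemma measurable_forall (I : finType) (A : I -> set O) :
  (forall i, measurable (A i)) -> measurable [set w | forall i, A i w].
Proof.
move=> mA.
rewrite [X in measurable X](_ : _ = \bigcap_(i in [set: I]) A i).
  by apply: fin_bigcap_measurable => // i _; exact: mA.
by apply/seteqP; split=> [w Aw i _|w Aw i]; exact: Aw.
Qed.

(** One coordinate after another is moved from the generating pi-system to the
    whole sigma-algebra, since two finite measures that agree on a pi-system
    agree on what it generates. *)
Lemma iid_as_generated (mu : probability S R) (I : finType)
    (V : I -> O -> S) (G : set (set S)) :
  (forall i, measurable_fun setT (V i)) ->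
  @measurable _ S = <<s G >> -> setI_closed G -> G setT ->
  (forall A : I -> set S, (forall i, G (A i)) ->
    P [set w | forall i, A i (V i w)] = (\prod_i fine (mu (A i)))%:E) ->
  iid_as P mu V.
Proof.
move=> mV mG GI GT HG.
have Gm A : G A -> measurable A by rewrite mG; exact: sub_sigma_algebra.
suff H (r : seq I) (A : I -> set S) :
    (forall i, if i \in r then measurable (A i) else G (A i)) ->
    P [set w | forall i, A i (V i w)] = (\prod_i fine (mu (A i)))%:E.
  by move=> A mA; apply: (H (enum I)) => i; rewrite mem_enum inE; exact: mA.
elim: r A => [|j r IH] A mA; first by apply: HG => i; have := mA i.
have mAA i : measurable (A i).
  by have := mA i; case: ifP => _ //; exact: Gm.
pose B (E : set S) i := if i == j then E else A i.
pose D := [set w | forall i, i != j -> A i (V i w)].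
have mD : measurable D.
  rewrite [D](_ : _ = [set w | forall i, B setT i (V i w)]); last first.
    apply/seteqP; split=> [w Dw i|w Bw i ij].
      by rewrite /B; case: eqVneq => // /Dw.
    by have := Bw i; rewrite /B (negbTE ij).
  apply: measurable_forall => i; rewrite -[X in measurable X]setTI.
  by apply: mV => //; rewrite /B; case: ifP.
have BE E : [set w | forall i, B E i (V i w)] = V j @^-1` E `&` D.
  apply/seteqP; split=> [w Bw|w [Ew Dw] i].
    split=> [|i ij]; first by have := Bw j; rewrite /B eqxx.
    by have := Bw i; rewrite /B (negbTE ij).
  by rewrite /B; case: (eqVneq i j) => [->//|]; exact: Dw.
pose c := \prod_(i | i != j) fine (mu (A i)).
have c0 : 0 <= c by apply: prodr_ge0 => i _; rewrite fine_ge0.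
have BprodE E : \prod_i fine (mu (B E i)) = fine (mu E) * c.
  rewrite (bigD1 j)//= /B eqxx; congr (_ * _).
  by apply: eq_bigr => i /negbTE ->.
have GBE E : G E -> P (V j @^-1` E `&` D) = (c%:E * mu E)%E.
  move=> GE; rewrite -BE IH; last first.
    move=> i; rewrite /B; have := mA i; rewrite inE.
    by case: (eqVneq i j) => [_ _|_ //]; case: ifP => _ //; exact: Gm.
  by rewrite BprodE EFinM fineK ?fin_num_measure//; [rewrite muleC|exact: Gm].
pose nu := [the measure _ _ of pushforward (mrestr P mD) (V j)].
pose nu1 := nu (mV j).
pose nu2 := [the measure _ _ of mscale (NngNum c0) mu].
have nu12 : nu1 (A j) = nu2 (A j).
  apply: (measure_unique G (fun=> setT)) => //.
  - by rewrite bigcup_const//; exists 0%N.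
  - move=> _; suff : (P (V j @^-1` setT `&` D) < +oo)%E by [].
    by rewrite GBE// probability_setT mule1 ltry.
have -> : [set w | forall i, A i (V i w)] = V j @^-1` A j `&` D.
  rewrite -BE; apply: eq_set => w; apply/propext; split=> Aw i.
    by rewrite /B; case: eqVneq => [->|].
  by have := Aw i; rewrite /B; case: eqVneq => [->|].
rewrite (bigD1 j)//= -/c EFinM fineK ?fin_num_measure// muleC.
exact: nu12.
Qed.

End iid_as.

(** * The law of a tuple of i.i.d. variables *)

Section boxes.
Context {d : measure_display} {T : measurableType d} (n : nat).

Definition box (A : 'I_n -> set T) : set (n.-tuple T) :=
  [set x | forall i, A i (tnth x i)].

Definition boxes : set (set (n.-tuple T)) :=
  [set E | exists2 A, (forall i, measurable (A i)) & E = box A].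

Lemma measurable_box A : (forall i, measurable (A i)) -> measurable (box A).
Proof.
move=> mA; apply: measurable_forall => i; rewrite -[X in measurable X]setTI.
by apply: measurable_tnth => //; exact: mA.
Qed.

Lemma measurable_tuple_boxes : @measurable _ (n.-tuple T) = <<s boxes >>.
Proof.
apply/seteqP; split; last first.
  apply: smallest_sub; first exact: sigma_algebra_measurable.
  by move=> _ [A mA ->]; exact: measurable_box.
apply: smallest_sub; first exact: smallest_sigma_algebra.
rewrite -bigcup_seq => _ [i _ [B mB <-]]; apply: sub_sigma_algebra.
exists (fun j => if j == i then B else setT) => [j|].
  by case: ifP.
apply/seteqP; split=> x /=.
  by move=> [_ Bx] j; case: eqVneq => [->|].
by move=> /(_ i); rewrite eqxx.
Qed.

Lemma boxes_setI : setI_closed boxes.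
Proof.
move=> _ _ [A mA ->] [B mB ->]; exists (fun i => A i `&` B i) => [i|].
  exact: measurableI.
by apply/seteqP; split=> x => [[Ax Bx] i|ABx]; [|split=> i; case: (ABx i)].
Qed.

Lemma boxes_setT : boxes setT.
Proof. by exists (fun=> setT) => //; apply/seteqP. Qed.

End boxes.

Lemma measurable_tuple_of {d dS : measure_display} {O : measurableType d}
    {S : measurableType dS} (n : nat) (V : 'I_n -> O -> S) :
  (forall i, measurable_fun setT (V i)) ->
  measurable_fun setT (fun w => [tuple V i w | i < n]).
Proof.
move=> mV; apply/measurable_fun_tnthP => i.
by rewrite (_ : _ \o _ = V i)//; apply/funext => w /=; rewrite tnth_mktuple.
Qed.

Lemma tuple_preimage_box {d dS : measure_display} {O : measurableType d}
    {S : measurableType dS} (n : nat) (V : 'I_n -> O -> S) (A : 'I_n -> set S) :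
  (fun w => [tuple V i w | i < n]) @^-1` box A =
  [set w | forall i, A i (V i w)].
Proof.
apply/seteqP; split=> w /= Aw i; first by have := Aw i; rewrite tnth_mktuple.
by rewrite tnth_mktuple; exact: Aw.
Qed.

Section iid_as_law.
Context {d d' dS : measure_display} {O : measurableType d}
  {O' : measurableType d'} {S : measurableType dS} {R : realType}.
Variables (P : probability O R) (P' : probability O' R) (mu : set S -> \bar R).
Variables (k : nat) (V : 'I_k -> O -> S) (V' : 'I_k -> O' -> S).
Hypotheses (mV : forall i, measurable_fun setT (V i))
  (mV' : forall i, measurable_fun setT (V' i)).
Hypotheses (iidV : iid_as P mu V) (iidV' : iid_as P' mu V').

Let T w := [tuple V i w | i < k].
Let T' w := [tuple V' i w | i < k].
Let mT : measurable_fun setT T := measurable_tuple_of mV.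
Let mT' : measurable_fun setT T' := measurable_tuple_of mV'.

(** The product rule gives the law on boxes, a pi-system that generates the
    sigma-algebra of the tuples. *)
Lemma iid_as_law_unique (E : set (k.-tuple S)) : measurable E ->
  P (T @^-1` E) = P' (T' @^-1` E).
Proof.
pose nu := [the measure _ _ of pushforward P T].
pose nu' := [the measure _ _ of pushforward P' T'].
move=> mE; suff : nu mT E = nu' mT' E by [].
apply: (measure_unique (@boxes _ S k) (fun=> setT)) => //.
- exact: measurable_tuple_boxes.
- exact: boxes_setI.
- by move=> _; exact: boxes_setT.
- by rewrite bigcup_const//; exists 0%N.
- move=> _ [A mA ->].
  transitivity (P (T @^-1` box A)) => //; rewrite tuple_preimage_box iidV//.
  by transitivity (P' (T' @^-1` box A)) => //; rewrite tuple_preimage_box iidV'.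
- move=> _; suff : (P (T @^-1` setT) < +oo)%E by [].
  by rewrite preimage_setT probability_setT ltry.
Qed.

Lemma ge0_iid_as_integral (F : k.-tuple S -> \bar R) :
  measurable_fun [set: k.-tuple S] F -> (forall x, 0 <= F x)%E ->
  (\int[P]_w F (T w) = \int[P']_w F (T' w))%E.
Proof.
move=> mF F0.
have := @ge0_integral_pushforward _ _ _ _ _ _ mT P setT F measurableT mF (fun x _ => F0 x).
rewrite preimage_setT => <-.
have := @ge0_integral_pushforward _ _ _ _ _ _ mT' P' setT F measurableT mF (fun x _ => F0 x).
rewrite preimage_setT => <-.
by apply: eq_measure_integral => E mE _; exact: iid_as_law_unique.
Qed.

Lemma iid_as_integral (F : k.-tuple S -> \bar R) :
  measurable_fun [set: k.-tuple S] F -> (\int[P]_w F (T w) = \int[P']_w F (T' w))%E.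
Proof.
move=> mF; rewrite integralE [RHS]integralE; congr (_ - _)%E.
  rewrite (funepos_comp F T) (funepos_comp F T').
  exact: ge0_iid_as_integral (measurable_funepos mF) (funepos_ge0 F).
rewrite (funeneg_comp F T) (funeneg_comp F T').
exact: ge0_iid_as_integral (measurable_funeneg mF) (funeneg_ge0 F).
Qed.

End iid_as_law.

Section iid_as_product.
Context {d dS : measure_display} {O : measurableType d}
  {S : measurableType dS} {R : realType}.
Variables (P : probability O R) (mu : probability S R).

(** The coordinates outside the range of [s] get the full set, which
    contributes the factor [1]. *)
Lemma iid_as_inj (I J : finType) (V : I -> O -> S) (s : J -> I) :
  injective s -> iid_as P mu V -> iid_as P mu (V \o s).
Proof.
move=> inj_s iidV A mA.
pose B i := if [pick j | s j == i] is Some j then A j else setT.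
have Bs j : B (s j) = A j.
  by rewrite /B; case: pickP => [j' /eqP/inj_s ->//|/(_ j)]; rewrite eqxx.
have -> : [set w | forall j, A j ((V \o s) j w)] = [set w | forall i, B i (V i w)].
  apply/seteqP; split=> w /= Aw i; last by rewrite -Bs; exact: Aw.
  by rewrite /B; case: pickP => // j /eqP <-; exact: Aw.
rewrite iidV => [|i]; last by rewrite /B; case: pickP.
rewrite (bigID (mem (s @: finset.setT)%SET))/= [X in _ * X]big1 => [|i].
  rewrite mulr1 big_imset/=; last by move=> ? ? _ _; exact: inj_s.
  congr (_%:E); apply: eq_big => [j|j _]; first by rewrite finset.in_setT.
  by rewrite Bs.
move=> si; rewrite /B; case: pickP => [j /eqP sj|_].
  by rewrite -sj imset_f ?finset.in_setT in si.
by rewrite probability_setT.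
Qed.

(** The first [k] variables and the last one are independent, which is again
    read off the boxes. *)
Lemma iid_as_recr (k : nat) (V : 'I_k.+1 -> O -> S) (E : set (k.-tuple S)) (B : set S) :
  (forall i, measurable_fun setT (V i)) -> iid_as P mu V ->
  measurable E -> measurable B ->
  let T w := [tuple V (widen_ord (leqnSn k) i) w | i < k] in
  (P (T @^-1` E `&` V ord_max @^-1` B) = P (T @^-1` E) * mu B)%E.
Proof.
move=> mV iidV mE mB T.
have mT : measurable_fun setT T by exact: measurable_tuple_of.
have mD : measurable (V ord_max @^-1` B) by rewrite -[X in measurable X]setTI; exact: mV.
have c0 : 0 <= fine (mu B) by rewrite fine_ge0.
pose nu := [the measure _ _ of pushforward (mrestr P mD) T].
pose nu' := [the measure _ _ of pushforward P T].
pose nu2 := [the measure _ _ of mscale (NngNum c0) (nu' mT)].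
have nu2E E' : nu2 E' = (P (T @^-1` E') * mu B)%E.
  transitivity ((fine (mu B))%:E * P (T @^-1` E'))%E => //.
  by rewrite fineK ?fin_num_measure// muleC.
rewrite -nu2E; suff : nu mT E = nu2 E by [].
apply: (measure_unique (@boxes _ S k) (fun=> setT)) => //.
- exact: measurable_tuple_boxes.
- exact: boxes_setI.
- by move=> _; exact: boxes_setT.
- by rewrite bigcup_const//; exists 0%N.
- move=> _ [A mA ->]; rewrite nu2E.
  transitivity (P (T @^-1` box A `&` V ord_max @^-1` B)) => //.
  rewrite tuple_preimage_box.
  have widen_inj : injective (widen_ord (leqnSn k)).
    by move=> i j /(congr1 val)/= /val_inj.
  rewrite [in RHS](iid_as_inj widen_inj iidV)//.
  pose A' i := if unlift ord_max i is Some j then A j else B.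
  have A'w j : A' (widen_ord (leqnSn k) j) = A j.
    rewrite /A' (_ : widen_ord _ j = lift ord_max j) ?liftK//.
    by apply: val_inj; rewrite /= /bump leqNgt ltn_ord.
  have A'm : A' ord_max = B by rewrite /A' unlift_none.
  have -> : [set w | forall i, A i (V (widen_ord (leqnSn k) i) w)] `&` V ord_max @^-1` B =
      [set w | forall i, A' i (V i w)].
    apply/seteqP; split=> w /=.
      move=> [Aw Bw] i; rewrite /A'; case: unliftP => [j ->|-> //].
      rewrite (_ : lift ord_max j = widen_ord (leqnSn k) j); first exact: Aw.
      by apply: val_inj; rewrite /= /bump leqNgt ltn_ord.
    by move=> Aw; split=> [i|]; [rewrite -A'w|rewrite -A'm]; exact: Aw.
  rewrite iidV => [|i]; last by rewrite /A'; case: unlift.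
  rewrite big_ord_recr/= A'm EFinM fineK ?fin_num_measure//.
  by congr (_%:E * _)%E; apply: eq_bigr => i _; rewrite A'w.
- move=> _; suff : (P (T @^-1` setT `&` V ord_max @^-1` B) < +oo)%E by [].
  by rewrite (le_lt_trans (probability_le1 _ _))// ?ltry//= preimage_setT setTI.
Qed.

(** Expectation is multiplicative over independent variables. By induction on
    [k], the pair formed by the first [k] variables and the last one has a
    product law, over which Tonelli's theorem splits the integral. *)
Lemma integral_prod_iid_as_le (f : S -> R) (e : R) (k : nat) (V : 'I_k -> O -> S) :
  measurable_fun setT f -> (forall x, 0 <= f x) ->
  (\int[mu]_x (f x)%:E <= e%:E)%E ->
  (forall i, measurable_fun setT (V i)) -> iid_as P mu V ->
  (\int[P]_w (\prod_(i < k) f (V i w))%:E <= (e ^+ k)%:E)%E.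
Proof.
move=> mf f0 fe; elim: k V => [|k IH] V mV iidV.
  under eq_integral do rewrite big_ord0.
  by rewrite integral_cst//= probability_setT mule1.
have widen_inj : injective (widen_ord (leqnSn k)).
  by move=> i j /(congr1 val)/= /val_inj.
pose W i := V (widen_ord (leqnSn k) i).
have mW i : measurable_fun setT (W i) by exact: mV.
have mT := measurable_tuple_of mW.
pose T : {mfun O >-> k.-tuple S} := mfun_Sub (mem_set mT).
pose F (x : k.-tuple S) := \prod_(i < k) f (tnth x i).
have mF : measurable_fun setT F.
  by apply: measurable_prod => i _; apply: measurableT_comp => //; exact: measurable_tnth.
have F0 x : 0 <= F x by exact: prodr_ge0.
have e0 : 0 <= e.
  by rewrite -lee_fin (le_trans _ fe)//; apply: integral_ge0 => x _; rewrite lee_fin.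
pose H (p : k.-tuple S * S) := (F p.1 * f p.2)%:E.
have mH : measurable_fun setT H.
  apply/measurable_EFinP; apply: measurable_funM; exact: measurableT_comp.
have H0 p : (0 <= H p)%E by rewrite lee_fin mulr_ge0.
have mTV : measurable_fun setT (fun w => (T w, V ord_max w)).
  by apply: measurable_fun_pair => //; exact: mV.
pose nu := [the measure _ _ of pushforward P (fun w => (T w, V ord_max w))].
pose PT : probability (k.-tuple S) R := distribution P T.
have nuE X : measurable X -> (PT \x mu)%E X = nu mTV X.
  move=> mX; apply: (@product_measure_unique _ _ _ _ _ PT mu (nu mTV)) => // E B mE mB.
  exact: (iid_as_recr mV iidV mE mB).
have -> : (\int[P]_w (\prod_(i < k.+1) f (V i w))%:E = \int[(PT \x mu)%E]_p H p)%E.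
  rewrite (eq_measure_integral (nu mTV)); last by move=> X mX _; exact: nuE.
  rewrite ge0_integral_pushforward//=.
  rewrite preimage_setT; apply: eq_integral => w _ /=.
  rewrite big_ord_recr/= /H/= /F; congr (_ * _)%:E.
  by apply: eq_bigr => i _; rewrite tnth_mktuple.
rewrite (fubini_tonelli1 H mH H0)/= /fubini_F/=.
apply: (@le_trans _ _ (\int[PT]_x (F x * e)%:E)%E).
  apply: ge0_le_integral => //=.
  - by move=> x _; apply: integral_ge0 => y _; exact: H0.
  - exact: measurable_fun_fubini_tonelli_F.
  - by apply/measurable_EFinP; apply: measurable_funM.
  move=> x _; rewrite /H/=.
  under eq_integral do rewrite EFinM.
  rewrite ge0_integralZl//=; last 3 first.
    exact/measurable_EFinP.
    by move=> y _; rewrite lee_fin.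
    by rewrite lee_fin.
  by rewrite EFinM lee_wpmul2l// lee_fin.
under eq_integral do rewrite EFinM.
rewrite ge0_integralZr//=; last 2 first.
  exact/measurable_EFinP.
  by move=> y _; rewrite lee_fin.
rewrite exprSr EFinM lee_wpmul2r ?lee_fin//.
rewrite ge0_integral_distribution//; last exact/measurable_EFinP.
apply: le_trans (IH W mW (iid_as_inj widen_inj iidV)).
rewrite le_eqVlt; apply/orP; left; apply/eqP; apply: eq_integral => w _ /=.
by congr (_%:E); apply: eq_bigr => i _; rewrite tnth_mktuple.
Qed.

End iid_as_product.

(** * Functions, blocks and pairs of independent families *)

Section iid_as_constructions.
Context {d dS dT : measure_display} {O : measurableType d}
  {S : measurableType dS} {T : measurableType dT} {R : realType}.
Variable P : probability O R.

Lemma iid_with_law_iid_as (I : finType) (X : I -> {RV P >-> S}) law :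
  iid_with_law P X law -> iid_as P law X.
Proof.
move=> [indX lawX] A mA.
have -> : [set w | forall i, A i (X i w)] =
    [set w | forall i, i \in [set: I]%SET -> A i (X i w)].
  by apply/seteqP; split=> w Aw i => [_|]; apply: Aw; rewrite ?finset.in_setT.
rewrite indX//; congr (_%:E); apply: eq_big => [i|i _].
  by rewrite finset.in_setT.
by rewrite -(lawX i).
Qed.

Lemma iid_as_comp (mu : set S -> \bar R) (I : finType) (V : I -> O -> S) (f : S -> T) :
  measurable_fun setT f -> iid_as P mu V ->
  iid_as P (pushforward mu f) (fun i => f \o V i).
Proof.
move=> mf iidV A mA.
rewrite -(iidV (fun i => f @^-1` A i))// => i.
by rewrite -[X in measurable X]setTI; exact: mf.
Qed.

(** On boxes the product over the blocks of the products over the positions is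
    the product over all pairs, so the product rule for single variables is the
    one for blocks. *)
Lemma iid_as_blocks (m : nat) (K : finType) (law : set S -> \bar R)
    (mu : probability (m.-tuple S) R) (V : K * 'I_m -> O -> S) :
  (forall p, measurable_fun setT (V p)) -> iid_as P law V ->
  (forall A : 'I_m -> set S, (forall a, measurable (A a)) ->
    mu (box A) = (\prod_a fine (law (A a)))%:E) ->
  iid_as P mu (fun j w => [tuple V (j, a) w | a < m]).
Proof.
move=> mV iidV muE.
apply: (@iid_as_generated _ _ _ _ _ P mu _ _ (@boxes _ S m)).
- by move=> j; apply: measurable_tuple_of => a; exact: mV.
- exact: measurable_tuple_boxes.
- exact: boxes_setI.
- exact: boxes_setT.
move=> E Ebox; have [A mA EA] := all_sig2 (fun j => cid2 (Ebox j)).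
have -> : [set w | forall j, E j [tuple V (j, a) w | a < m]] =
    [set w | forall p : K * 'I_m, A p.1 p.2 (V p w)].
  apply/seteqP; split=> w /= Ew.
    by move=> [j a]; have := Ew j; rewrite EA => /(_ a); rewrite tnth_mktuple.
  by move=> j; rewrite EA => a; rewrite tnth_mktuple; exact: (Ew (j, a)).
rewrite (iidV (fun p => A p.1 p.2)) => [|p]; last exact: mA.
congr (_%:E); rewrite -(pair_bigA _ (fun j a => fine (law (A j a))))/=.
by apply: eq_bigr => j _; rewrite EA muE.
Qed.

(** Independence between the two families is required for each family taken
    as a whole; the product rule for the pairs then holds on rectangles. *)
Lemma iid_as_pair (I : finType) (mu : probability S R) (nu : probability T R)
    (rho : probability (S * T)%type R) (V : I -> O -> S) (W : I -> O -> T) :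
  (forall i, measurable_fun setT (V i)) -> (forall i, measurable_fun setT (W i)) ->
  iid_as P mu V -> iid_as P nu W ->
  (forall A B, (forall i, measurable (A i)) -> (forall i, measurable (B i)) ->
    P [set w | (forall i, A i (V i w)) /\ (forall i, B i (W i w))] =
    (P [set w | forall i, A i (V i w)] * P [set w | forall i, B i (W i w)])%E) ->
  (forall A B, measurable A -> measurable B -> rho (A `*` B) = (mu A * nu B)%E) ->
  iid_as P rho (fun i w => (V i w, W i w)).
Proof.
move=> mV mW iidV iidW indVW rhoE.
apply: (@iid_as_generated _ _ _ _ _ P rho _ _
  [set A `*` B | A in measurable & B in measurable]).
- by move=> i; exact: measurable_fun_pair.
- exact: measurable_prod_measurableType.
- move=> _ _ [A mA [B mB <-]] [A' mA' [B' mB' <-]]; rewrite -setXI.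
  by exists (A `&` A'); [exact: measurableI|exists (B `&` B') => //; exact: measurableI].
- by exists setT => //; exists setT => //; rewrite setXTT.
move=> E EAB.
have [A mA HA] := all_sig2 (fun i => cid2 (EAB i)).
have [B mB EE] := all_sig2 (fun i => cid2 (HA i)).
have -> : [set w | forall i, E i (V i w, W i w)] =
    [set w | (forall i, A i (V i w)) /\ (forall i, B i (W i w))].
  apply/seteqP; split=> w /= => [Ew|[Aw Bw] i]; last by rewrite -EE; split.
  by split=> i; have := Ew i; rewrite -EE => -[].
rewrite indVW// iidV// iidW// -EFinM -big_split/=; congr (_%:E).
by apply: eq_bigr => i _; rewrite -EE rhoE// fineM ?fin_num_measure.
Qed.

End iid_as_constructions.

(** * Convex functions and their expectations *)

Section convex_functions.
Context {R : realType}.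
Variable Phi : R -> R.
Hypothesis Phi_cvx : convex_function [set: R^o] Phi.

Lemma convex_combination (t x y : R) : 0 <= t -> t <= 1 ->
  Phi (t * x + (1 - t) * y) <= t * Phi x + (1 - t) * Phi y.
Proof.
move=> t0 t1; have t01 : 0 <= t <= 1 by rewrite t0.
have := @Phi_cvx (Itv01 t0 t1) x y; rewrite !inE => /(_ Logic.I Logic.I).
by [].
Qed.

Lemma convex_slopes (x c y : R) : x < c -> c < y ->
  (Phi c - Phi x) / (c - x) <= (Phi y - Phi c) / (y - c).
Proof.
move=> xc cy.
have xy : 0 < y - x by rewrite subr_gt0 (lt_trans xc).
have cx0 : 0 < c - x by rewrite subr_gt0.
have yc0 : 0 < y - c by rewrite subr_gt0.
rewrite ler_pdivrMr// mulrAC ler_pdivlMr//.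
have t0 : 0 <= (y - c) / (y - x) by rewrite divr_ge0 ?ltW.
have t1 : (y - c) / (y - x) <= 1 by rewrite ler_pdivrMr// mul1r lerD2l lerN2 ltW.
have := convex_combination x y t0 t1.
have -> : (y - c) / (y - x) * x + (1 - (y - c) / (y - x)) * y = c.
  by field; rewrite gt_eqF.
rewrite -(ler_pM2r xy).
have -> : ((y - c) / (y - x) * Phi x + (1 - (y - c) / (y - x)) * Phi y) * (y - x) =
    (y - c) * Phi x + (c - x) * Phi y.
  by field; rewrite gt_eqF.
move=> H; rewrite -subr_ge0; rewrite -subr_ge0 in H.
by apply: le_trans H _; rewrite le_eqVlt; apply/orP; left; apply/eqP; ring.
Qed.

(** The slope is the supremum of the slopes of the chords to the left of [c],
    which are all bounded by each slope to the right. *)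
Lemma convex_subgradient (c : R) : exists b, forall x, Phi c + b * (x - c) <= Phi x.
Proof.
pose D := [set s | exists2 x, x < c & s = (Phi c - Phi x) / (c - x)].
have supD : has_sup D.
  split; first by exists ((Phi c - Phi (c - 1)) / (c - (c - 1))), (c - 1) => //; lra.
  exists ((Phi (c + 1) - Phi c) / (c + 1 - c)) => _ [x xc ->].
  by apply: convex_slopes => //; rewrite ltrDl.
exists (sup D) => x; have [xc|cx|->] := ltgtP x c; last by rewrite subrr mulr0 addr0.
- rewrite addrC -lerBrDr -ler_ndivrMr ?subr_lt0//.
  rewrite -[leLHS]divrNN !opprB; apply: ub_le_sup; first by case: supD.
  by exists x.
- rewrite addrC -lerBrDr -ler_pdivlMr ?subr_gt0//.
  apply: ge_sup; first by case: supD.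
  by move=> _ [y yc ->]; exact: convex_slopes.
Qed.

(** The sublevel sets of a convex function are intervals: at a point [z]
    between [x] and [y], the supporting line at [z] shows that the value at [x]
    or at [y], according to the sign of its slope, is at least the one at
    [z]. *)
Lemma convex_measurable : measurable_fun setT Phi.
Proof.
move=> _; apply: (measurability _ (RGenInftyO.measurableE R)) => //.
move=> /= _ [_ [a ->] <-]; rewrite setTI; apply: is_interval_measurable.
move=> x y /=; rewrite !in_itv/= => xa ya z /andP[xz zy].
rewrite /= in_itv/=.
have [->//|zx] := eqVneq z x; have [->//|zy'] := eqVneq z y.
have {}xz : x < z by rewrite lt_neqAle eq_sym zx.
have {}zy : z < y by rewrite lt_neqAle zy'.
have [b zb] := convex_subgradient z.
have [b0|b0] := leP 0 b.
  by rewrite (le_lt_trans _ ya)// (le_trans _ (zb y))// lerDl mulr_ge0// subr_ge0 ltW.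
rewrite (le_lt_trans _ xa)// (le_trans _ (zb x))// lerDl.
by rewrite mulr_le0// ?subr_le0 ltW.
Qed.

(** Average the supporting line at the mean of the [x i]. *)
Lemma jensen_average (I : finType) (x : I -> R) (N := #|I|%:R : R) : (0 < #|I|)%N ->
  Phi (N^-1 * \sum_i x i) <= N^-1 * \sum_i Phi (x i).
Proof.
move=> I0; have N0 : 0 < N by rewrite ltr0n.
set c := N^-1 * _; have [b cb] := convex_subgradient c.
rewrite mulrC ler_pdivlMr//.
apply: (@le_trans _ _ (\sum_i (Phi c + b * (x i - c)))); last exact: ler_sum.
rewrite big_split/= sumr_const -mulr_sumr sumrB sumr_const -(mulr_natr c) -/N.
by rewrite /c mulrAC mulVf ?gt_eqF// mul1r subrr mulr0 addr0 mulr_natr.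
Qed.

End convex_functions.

Section convex_expectation.
Context {d : measure_display} {O : measurableType d} {R : realType}.
Variable P : probability O R.

(** The negative part is dominated by the one of [g], so only the integral of
    the positive part can be infinite. *)
Lemma bounded_below_integrable (f g : O -> R) :
  measurable_fun setT f -> P.-integrable setT (EFin \o g) ->
  (forall w, g w <= f w) ->
  P.-integrable setT (EFin \o f) \/ (\int[P]_w (f w)%:E = +oo)%E.
Proof.
move=> mf ig gf.
have mf' : measurable_fun setT (EFin \o f) by exact/measurable_EFinP.
have fneg : (\int[P]_w (EFin \o f)^\- w < +oo)%E.
  apply: le_lt_trans (integral_funeneg_lt_pinfty measurableT ig).
  apply: ge0_le_integral => //.
  - exact: measurable_funeneg.
  - by apply: measurable_funeneg; case/integrableP: ig.
  - move=> w _; apply: (@funeneg_le _ _ setT); rewrite ?inE// => x _.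
    by rewrite lee_fin.
have [fpos|fpos] := ltP (\int[P]_w (EFin \o f)^\+ w)%E +oo%E; [left|right].
  apply/integrableP; split=> //; rewrite -/(abse \o _).
  under eq_integral do rewrite -[`|_|%E]/((abse \o (EFin \o f)) _) fune_abse.
  rewrite ge0_integralD//=; first exact: lte_add_pinfty.
  - exact: measurable_funepos.
  - exact: measurable_funeneg.
move: fpos; rewrite leye_eq => /eqP fpos.
rewrite integralE -/(EFin \o f) fpos addye// eqe_oppLR/=.
by rewrite lt_eqF.
Qed.

(** Monotonicity holds for all measurable functions, integrable or not, since
    the positive parts and the negative parts are ordered separately. *)
Lemma le_integral_EFin (f g : O -> R) :
  measurable_fun setT f -> measurable_fun setT g -> (forall w, f w <= g w) ->
  (\int[P]_w (f w)%:E <= \int[P]_w (g w)%:E)%E.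
Proof.
move=> mf mg fg.
have mf' : measurable_fun setT (EFin \o f) by exact/measurable_EFinP.
have mg' : measurable_fun setT (EFin \o g) by exact/measurable_EFinP.
have fg' : {in setT, forall w, ((EFin \o f) w <= (EFin \o g) w)%E}.
  by move=> w _; rewrite lee_fin.
rewrite integralE [leRHS]integralE leeB//; apply: ge0_le_integral => //.
- exact: measurable_funepos.
- exact: measurable_funepos.
- by move=> w _; apply: (funepos_le fg'); rewrite inE.
- exact: measurable_funeneg.
- exact: measurable_funeneg.
- by move=> w _; apply: (funeneg_le fg'); rewrite inE.
Qed.

Lemma integrable_affine (f : O -> R) (a b : R) :
  P.-integrable setT (EFin \o f) ->
  P.-integrable setT (EFin \o (fun w => a + b * f w)).
Proof.
move=> fi; rewrite (_ : EFin \o _ = (EFin \o cst a) \+ (fun w => b%:E * (EFin \o f) w))%E.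
  apply: integrableD => //; last exact: integrableZl.
  by apply/finite_measure_integrable_cst.
by apply/funext => w /=.
Qed.

(** Jensen's inequality over the uniform weights, integrated; if [r] is finite
    then every [Phi \o W i] is integrable and the average of their integrals
    is [r]. *)
Lemma convex_average_expectation_le (Phi : R -> R) (I : finType)
    (W : I -> O -> R) (r : \bar R) :
  convex_function [set: R^o] Phi -> (0 < #|I|)%N ->
  (forall i, P.-integrable setT (EFin \o W i)) ->
  (forall i, \int[P]_w (Phi (W i w))%:E = r)%E ->
  (\int[P]_w (Phi (#|I|%:R^-1 * \sum_i W i w))%:E <= r)%E.
Proof.
move=> cvx I0 iW Wr.
have mPhi := convex_measurable cvx.
have mW i : measurable_fun setT (W i).
  by case/integrableP: (iW i) => /measurable_EFinP.
have mPW i : measurable_fun setT (Phi \o W i) by exact: measurableT_comp.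
have [b zb] := convex_subgradient cvx 0.
have below i w : Phi 0 + b * W i w <= (Phi \o W i) w.
  by have := zb (W i w); rewrite subr0.
have dich i := bounded_below_integrable (mPW i) (integrable_affine (Phi 0) b (iW i)) (below i).
have [->|r_fin] := eqVneq r +oo%E; first exact: leey.
have iPW i : P.-integrable setT (EFin \o (Phi \o W i)).
  by case: (dich i) => //; rewrite Wr => rE; rewrite rE eqxx in r_fin.
have N0 : #|I|%:R != 0 :> R by rewrite pnatr_eq0 -lt0n.
have msum (F : I -> O -> R) : (forall i, measurable_fun setT (F i)) ->
    measurable_fun setT (fun w => #|I|%:R^-1 * \sum_i F i w).
  by move=> mF; apply: measurable_funM => //; exact: measurable_sum.
apply: (@le_trans _ _ (\int[P]_w (#|I|%:R^-1 * \sum_i (Phi \o W i) w)%:E)%E).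
  apply: le_integral_EFin; last by move=> w; exact: jensen_average.
    by apply: measurableT_comp => //; exact: msum.
  exact: msum.
under eq_integral do rewrite EFinM -sumEFin.
rewrite integralZl//=; last first.
  by apply: integrable_sum => // i _; exact: iPW.
rewrite integral_sum//=.
under eq_bigr do rewrite Wr.
have rf : r \is a fin_num.
  by case/card_gt0P: I0 => i _; rewrite -(Wr i); exact: (integrable_fin_num measurableT (iPW i)).
rewrite -(fineK rf) sumEFin sumr_const -EFinM lee_fin -(mulr_natl (fine r)) mulrA mulVf//.
by rewrite mul1r.
Qed.

End convex_expectation.

(** * Inequalities for the exponential *)

Section exponential_inequalities.
Context {R : realType}.
Implicit Types x y p h : R.

Lemma expR_tail_cvg x :
  (\sum_(i < n) x ^+ i.+2 / i.+2`!%:R) @[n --> \oo] --> expR x - 1 - x.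
Proof.
have cvg_exp : series (exp_coeff x) n.+2 @[n --> \oo] --> expR x.
  have := @is_cvg_series_exp_coeff R x; rewrite -(cvg_shiftn 2).
  by under eq_fun do rewrite addn2.
rewrite (_ : (fun _ => _) = (fun n => series (exp_coeff x) n.+2 - 1 - x)).
  by apply: cvgB; [apply: cvgB => //|]; exact: cvg_cst.
apply/funext => n; rewrite /series/= big_mkord 2!big_ord_recl/= /exp_coeff/=.
rewrite expr0 expr1 !divr1 [1 + _]addrC addrK [x + _]addrC addrK.
by apply: eq_bigr.
Qed.

(** Each term of the series satisfies the inequality, because
    [x^(i+2) <= x^2 y^i]; this is the monotonicity of
    [x |-> (e^x - 1 - x) / x^2] in a form that also covers negative [x]. *)
Lemma expR_tail_ratio x y : `|x| <= y ->
  y ^+ 2 * (expR x - 1 - x) <= x ^+ 2 * (expR y - 1 - y).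
Proof.
move=> xy; have y0 : 0 <= y by rewrite (le_trans _ xy).
have cvgl : y ^+ 2 * (\sum_(i < n) x ^+ i.+2 / i.+2`!%:R) @[n --> \oo] -->
    y ^+ 2 * (expR x - 1 - x) by apply: cvgMl_tmp; exact: expR_tail_cvg.
have cvgr : x ^+ 2 * (\sum_(i < n) y ^+ i.+2 / i.+2`!%:R) @[n --> \oo] -->
    x ^+ 2 * (expR y - 1 - y) by apply: cvgMl_tmp; exact: expR_tail_cvg.
apply: (ler_cvg_to cvgl cvgr).
near=> n; rewrite !mulr_sumr; apply: ler_sum => i _.
have powE (z : R) : z ^+ i.+2 = z ^+ i * z ^+ 2 by rewrite -addn2 exprD.
rewrite !powE [leLHS]mulrA [leRHS]mulrA ler_pM2r ?invr_gt0 ?ltr0n ?fact_gt0//.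
rewrite mulrCA [leRHS]mulrCA [x ^+ 2 * _]mulrC ler_wpM2r//; first by rewrite -exprMn sqr_ge0.
by rewrite (le_trans (ler_norm _))// normrX lerXn2r// nnegrE.
Unshelve. all: by end_near. Qed.

(** Since [(i+2)! >= 2 * 3^i], the series is dominated by a geometric one of
    ratio [y / 3]. *)
Lemma expR_tail_bernstein y : 0 <= y -> y < 3 ->
  expR y - 1 - y <= y ^+ 2 / (2 * (1 - y / 3)).
Proof.
move=> y0 y3; have r1 : y / 3 < 1 by rewrite ltr_pdivrMr// mul1r.
have cvgl : (\sum_(i < n) y ^+ i.+2 / i.+2`!%:R) @[n --> \oo] --> expR y - 1 - y.
  exact: expR_tail_cvg.
apply: (ler_cvg_to cvgl (cvg_cst _)).
near=> n.
have fact_lb i : (2 * 3 ^ i <= i.+2`!)%N.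
  elim: i => // i IH; rewrite factS expnS mulnCA leq_mul//.
apply: (@le_trans _ _ (\sum_(i < n) y ^+ 2 / 2 * (y / 3) ^+ i)).
  apply: ler_sum => i _; rewrite exprMn exprVn (_ : y ^+ i.+2 = y ^+ i * y ^+ 2); last by rewrite -addn2 exprD.
  rewrite mulrACA [y ^+ i * _]mulrC ler_wpM2l ?mulr_ge0 ?exprn_ge0//.
  by rewrite -invfM lef_pV2 ?posrE ?mulr_gt0 ?exprn_gt0 ?ltr0n ?fact_gt0//
    -natrX -natrM ler_nat.
rewrite -mulr_sumr invfM mulrA ler_wpM2l ?divr_ge0 ?sqr_ge0//.
rewrite -[leRHS]mul1r ler_pdivlMr ?subr_gt0//.
rewrite mulrC -opprB mulNr -subrX1 opprB gerBl exprn_ge0//.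
by rewrite divr_ge0.
Unshelve. all: by end_near. Qed.

Let u p h := 1 - p + p * expR h.

Let u_gt0 p h : 0 <= p -> p <= 1 -> 0 < u p h.
Proof.
move=> p0 p1; rewrite /u; have := expR_gt0 h; nra.
Qed.

Let derive_u p h : is_derive h 1 (u p) (p * expR h).
Proof.
rewrite /u; apply: is_derive_eq.
by rewrite /GRing.scale/=; ring.
Qed.

(** The tilted Bernoulli mean [p e^h / (1 - p + p e^h)] has derivative equal to
    a Bernoulli variance, hence at most [1 / 4]. *)
Let tilted_mean_le p h : 0 <= p -> p <= 1 -> 0 <= h ->
  p * expR h / u p h <= p + h / 4.
Proof.
move=> p0 p1 h0.
pose q := fun x => p + x / 4 - p * expR x / u p x.
have dq (x : R) : is_derive x 1 q (1 / 4 - (1 - p) * (p * expR x) / u p x ^+ 2).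
  have ux : u p x != 0 by rewrite gt_eqF// u_gt0.
  rewrite /q; have duV := is_deriveV ux (derive_u p x).
  apply: is_derive_eq.
  rewrite /GRing.scale/=; rewrite /u in ux *; field.
  by [].
suff : q 0 <= q h by rewrite /q /u expR0 mul0r addr0 mulr1 subrK divr1 subrr subr_ge0.
apply: (@ger0_derive1_ndecry R q 0) => //.
- move=> x _ /=; rewrite derive1E derive_val.
  have := u_gt0 x p0 p1 => ux.
  rewrite subr_ge0 ler_pdivrMr ?exprn_gt0//.
  have := sqr_ge0 (1 - p - p * expR x); rewrite /u; nra.
- by apply: continuous_subspaceT => x; apply: differentiable_continuous; apply/derivable1_diffP.
Qed.

Let bernoulli_mgf_ge0 p h : 0 <= p -> p <= 1 -> 0 <= h ->
  1 - p + p * expR h <= expR (p * h + h ^+ 2 / 8).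
Proof.
move=> p0 p1 h0.
pose f := fun x => p * x + x ^+ 2 / 8 - ln (u p x).
have df (x : R) : is_derive x 1 f (p + x / 4 - p * expR x / u p x).
  rewrite /f; have dln := is_derive1_comp (is_derive1_ln (u_gt0 x p0 p1)) (derive_u p x).
  rewrite -/((@ln R \o u p) x) in dln *.
  apply: is_derive_eq.
  by rewrite /GRing.scale/=; field; rewrite gt_eqF ?u_gt0.
suff : f 0 <= f h.
  rewrite /f /u expR0 mulr0 expr0n mul0r !addr0 mulr1 subrK ln1 subrr subr_ge0.
  by rewrite -ler_expR lnK// posrE u_gt0.
apply: (@ger0_derive1_ndecry R f 0) => //.
- move=> x; rewrite in_itv/= andbT => x0; rewrite derive1E derive_val.
  by rewrite subr_ge0 tilted_mean_le// ltW.
- by apply: continuous_subspaceT => x; apply: differentiable_continuous; apply/derivable1_diffP.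
Qed.

(** Hoeffding's lemma for a Bernoulli variable of mean [p]: the logarithm of
    the right-hand side over the left-hand side vanishes at [0] and its
    derivative [p + h / 4 - p e^h / (1 - p + p e^h)] is nonnegative for
    [h >= 0]. Negative [h] are reduced to positive ones by exchanging the two
    values of the variable. *)
Lemma bernoulli_mgf_le p h : 0 <= p -> p <= 1 ->
  1 - p + p * expR h <= expR (p * h + h ^+ 2 / 8).
Proof.
move=> p0 p1; have [h0|/ltW h0] := leP 0 h; first exact: bernoulli_mgf_ge0.
have := @bernoulli_mgf_ge0 (1 - p) (- h).
rewrite subr_ge0 oppr_ge0 gerBl => /(_ p1 p0 h0).
rewrite -(ler_pM2l (expR_gt0 h)) -expRD.
rewrite (_ : h + ((1 - p) * - h + (- h) ^+ 2 / 8) = p * h + h ^+ 2 / 8); last by ring.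
rewrite expRN (_ : expR h * _ = 1 - p + p * expR h)//.
by field; rewrite gt_eqF ?expR_gt0.
Qed.

End exponential_inequalities.

(** * Moment generating functions of centered bounded variables *)

Section mgf_bounds.
Context {d : measure_display} {O : measurableType d} {R : realType}.
Variable P : probability O R.

Lemma integrable_bounded (f : O -> R) (b : R) : measurable_fun setT f ->
  (forall w, `|f w| <= b) -> P.-integrable setT (EFin \o f).
Proof.
move=> mf fb.
apply: (le_integrable measurableT (g := EFin \o cst b)).
- exact/measurable_EFinP.
- by move=> w _ /=; rewrite lee_fin (le_trans (fb w))// ler_norm.
- exact/finite_measure_integrable_cst.
Qed.

Lemma integral_affine (f : O -> R) (a b : R) : P.-integrable setT (EFin \o f) ->
  (\int[P]_w (a + b * f w)%:E = a%:E + b%:E * \int[P]_w (f w)%:E)%E.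
Proof.
move=> fi.
under eq_integral do rewrite EFinD EFinM.
rewrite integralD//=; last 2 first.
  exact/finite_measure_integrable_cst.
  exact: integrableZl.
rewrite integralZl// integral_cst//=.
by rewrite probability_setT mule1.
Qed.

Lemma convex_expRZ (l : R) : convex_function [set: R^o] (fun x : R => expR (l * x)).
Proof.
move=> t x y _ _; have := @convex_expR R t (l * x) (l * y).
rewrite (_ : conv t (l * x : R^o) (l * y) = l * conv t x y)//.
by rewrite !convRE mulrDr !(mulrCA l).
Qed.

(** Bounding the exponential by its chord on [[a, a + r]] replaces [D] by the
    centered variable with values [a] and [a + r], that is, by a scaled
    Bernoulli variable of mean [p = - a / r]. *)
Lemma hoeffding_mgf (D : O -> R) (a r l : R) : measurable_fun setT D -> 0 < r ->
  (forall w, a <= D w <= a + r) -> (\int[P]_w (D w)%:E = 0)%E ->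
  (\int[P]_w (expR (l * D w))%:E <= (expR (l ^+ 2 * (r ^+ 2 / 4) / 2))%:E)%E.
Proof.
move=> mD r0 Dar D0.
have iD : P.-integrable setT (EFin \o D).
  apply: (@integrable_bounded _ (`|a| + r)) => // w.
  have /andP[aD Dr] := Dar w; rewrite ler_norml; apply/andP; split.
    by have := ler_norm (- a); rewrite normrN; lra.
  by have := ler_norm a; lra.
have mean (c : R) : (\int[P]_w (c%:E) = c%:E)%E.
  by rewrite integral_cst//= probability_setT mule1.
have a0 : a <= 0.
  suff : (a%:E <= 0)%E by rewrite lee_fin.
  rewrite -D0 -(mean a); apply: le_integral_EFin => // w.
  by case/andP: (Dar w).
have ar0 : 0 <= a + r.
  suff : (0 <= (a + r)%:E)%E by rewrite lee_fin.
  rewrite -D0 -(mean (a + r)); apply: le_integral_EFin => // w.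
  by case/andP: (Dar w).
pose p := - a / r.
have p0 : 0 <= p by rewrite divr_ge0 ?oppr_ge0// ltW.
have p1 : p <= 1 by rewrite ler_pdivrMr// mul1r; lra.
pose al := (1 - p) * expR (l * a) + p * expR (l * (a + r)).
pose be := (expR (l * (a + r)) - expR (l * a)) / r.
apply: (@le_trans _ _ (\int[P]_w (al + be * D w)%:E)%E).
  apply: le_integral_EFin.
  - by apply: measurableT_comp => //; exact: measurable_funM.
  - by apply: measurable_funD => //; exact: measurable_funM.
  move=> w; have /andP[aD Dr] := Dar w.
  pose t := (a + r - D w) / r.
  have t0 : 0 <= t by rewrite divr_ge0 ?subr_ge0// ltW.
  have t1 : t <= 1 by rewrite ler_pdivrMr// mul1r; lra.
  have := convex_combination (convex_expRZ l) a (a + r) t0 t1.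
  rewrite /= (_ : t * a + (1 - t) * (a + r) = D w); last first.
    by rewrite /t; field; rewrite gt_eqF.
  move/le_trans; apply; rewrite le_eqVlt; apply/orP; left; apply/eqP.
  by rewrite /al /be /t /p; field; rewrite gt_eqF.
rewrite integral_affine// D0 mule0 adde0 lee_fin.
have -> : al = expR (l * a) * (1 - p + p * expR (l * r)).
  by rewrite /al mulrDr expRD; ring.
rewrite mulrC -ler_pdivlMr ?expR_gt0// -expRN -expRD.
apply: le_trans (bernoulli_mgf_le (l * r) p0 p1) _.
rewrite ler_expR le_eqVlt; apply/orP; left; apply/eqP.
by rewrite /p; field; rewrite gt_eqF.
Qed.

(** Pointwise, [e^(l D) <= 1 + l D + D^2 G] where
    [G = (e^(|l| b) - 1 - |l| b) / b^2], by monotonicity of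
    [(e^x - 1 - x) / x^2]. *)
Lemma bennett_mgf (D : O -> R) (b s l : R) : measurable_fun setT D -> 0 < b ->
  (forall w, `|D w| <= b) -> (\int[P]_w (D w)%:E = 0)%E ->
  (\int[P]_w (D w ^+ 2)%:E = s%:E)%E ->
  (\int[P]_w (expR (l * D w))%:E <=
    (expR (s / b ^+ 2 * (expR (`|l| * b) - 1 - `|l| * b)))%:E)%E.
Proof.
move=> mD b0 Db D0 D2.
have iD : P.-integrable setT (EFin \o D) by exact: integrable_bounded.
have iD2 : P.-integrable setT (EFin \o (fun w => D w ^+ 2)).
  apply: (@integrable_bounded _ (b ^+ 2)).
    exact: measurable_funX.
  by move=> w; rewrite normrX lerXn2r// nnegrE ltW.
pose G := (expR (`|l| * b) - 1 - `|l| * b) / b ^+ 2.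
apply: (@le_trans _ _ (\int[P]_w (1 + l * D w + G * D w ^+ 2)%:E)%E).
  apply: le_integral_EFin.
  - by apply: measurableT_comp => //; exact: measurable_funM.
  - apply: measurable_funD; first by apply: measurable_funD => //; exact: measurable_funM.
    by apply: measurable_funM => //; exact: measurable_funX.
  move=> w; have [l0|l0] := eqVneq l 0.
    by rewrite /G l0 normr0 !mul0r expR0 subrr subr0 !mul0r !addr0.
  have l2 : 0 < l ^+ 2 by rewrite exprn_even_gt0.
  have := @expR_tail_ratio R (l * D w) (`|l| * b).
  rewrite normrM ler_wpM2l// => /(_ isT).
  rewrite !exprMn real_normK ?num_real// /G => ratio.
  rewrite -lerBlDl opprD addrA -[_ / _ * _]mulrAC ler_pdivlMr ?exprn_gt0//.
  rewrite -(ler_pM2l l2) [_ * b ^+ 2]mulrC [_ * D w ^+ 2]mulrC.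
  by rewrite [leLHS]mulrA [leRHS]mulrA.
under eq_integral do rewrite EFinD.
rewrite integralD//=; last 2 first.
  exact: integrable_affine.
  exact: (integrableZl measurableT G iD2).
rewrite integral_affine// D0 mule0 adde0.
under eq_integral do rewrite EFinM.
rewrite integralZl// D2 -EFinM -EFinD lee_fin.
apply: le_trans (expR_ge1Dx _) _.
by rewrite ler_expR le_eqVlt; apply/orP; left; apply/eqP; rewrite /G; ring.
Qed.

Lemma bernstein_mgf (D : O -> R) (b s l : R) : measurable_fun setT D -> 0 < b ->
  (forall w, `|D w| <= b) -> (\int[P]_w (D w)%:E = 0)%E ->
  (\int[P]_w (D w ^+ 2)%:E = s%:E)%E -> `|l| * b < 3 ->
  (\int[P]_w (expR (l * D w))%:E <=
    (expR (l ^+ 2 * s / (2 * (1 - `|l| * b / 3))))%:E)%E.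
Proof.
move=> mD b0 Db D0 D2 lb3.
apply: le_trans (bennett_mgf l mD b0 Db D0 D2) _; rewrite lee_fin ler_expR.
have s0 : 0 <= s.
  by rewrite -lee_fin -D2; apply: integral_ge0 => w _; rewrite lee_fin sqr_ge0.
have lb0 : 0 <= `|l| * b by rewrite mulr_ge0// ltW.
have sb0 : 0 <= s / b ^+ 2 by rewrite divr_ge0 ?sqr_ge0.
apply: le_trans (ler_wpM2l sb0 (expR_tail_bernstein lb0 lb3)) _.
rewrite exprMn real_normK ?num_real// le_eqVlt; apply/orP; left; apply/eqP.
by field; rewrite !gt_eqF// subr_gt0.
Qed.

End mgf_bounds.

(** * Chernoff bounds from a transferred moment generating function *)

Lemma ln_confidence (R : realType) (delta : R) : 0 < delta -> delta < 1 ->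
  0 < ln (2 / delta) /\ 2 * expR (- ln (2 / delta)) = delta.
Proof.
move=> d0 d1; have d2 : 0 < 2 / delta by rewrite divr_gt0.
split; first by apply: ln_gt0; rewrite ltr_pdivlMr// mul1r; lra.
by rewrite expRN lnK ?posrE// invf_div; field.
Qed.

Section superlevel.
Context {d : measure_display} {O : measurableType d} {R : realType}.
Variable D : O -> R.
Hypothesis mD : measurable_fun setT D.

Lemma measurable_superlevel (t : R) : measurable [set w | t <= D w].
Proof.
rewrite -[X in measurable X]setTI.
have -> : [set w | t <= D w] = D @^-1` `[t, +oo[.
  by apply/seteqP; split=> w /=; rewrite in_itv/= andbT.
by apply: mD => //; exact: measurable_itv.
Qed.

End superlevel.

Section tails.
Context {d : measure_display} {O : measurableType d} {R : realType}.
Variables (P : probability O R) (D : O -> R).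
Hypothesis mD : measurable_fun setT D.

Let measurable_le_norm (t : R) : measurable [set w | t <= `|D w|].
Proof. by apply: measurable_superlevel; exact: measurableT_comp. Qed.

Lemma confidence_of_tail (t delta : R) :
  (P [set w | (t <= `|D w|)%R] <= delta%:E)%E ->
  ((1 - delta)%:E <= P [set w | (`|D w| <= t)%R])%E.
Proof.
move=> tail; apply: (@le_trans _ _ (P (~` [set w | t <= `|D w|]))).
  rewrite probability_setC; last exact: measurable_le_norm.
  by rewrite EFinB leeB.
apply: le_measure; rewrite ?inE.
- by apply: measurableC; exact: measurable_le_norm.
- rewrite (_ : [set w | _] = [set w | - t <= - `|D w|]).
    by apply: measurable_superlevel; do 2 apply: measurableT_comp => //.
  by apply/seteqP; split=> w /=; rewrite lerN2.
- by move=> w /= /negP; rewrite -ltNge => /ltW.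
Qed.

Lemma upper_tail (l g t : R) : 0 < l ->
  (\int[P]_w (expR (l * D w))%:E <= (expR g)%:E)%E ->
  (P [set w | (t <= D w)%R] <= (expR (g - l * t))%:E)%E.
Proof.
move=> l0 mgf.
pose X : {RV P >-> R} := mfun_Sub (mem_set mD).
apply: (le_trans (chernoff X t l0)).
rewrite expRD EFinM lee_wpmul2r// ?lee_fin ?expR_ge0//.
rewrite /mmt_gen_fun unlock; apply: le_trans mgf.
by under eq_integral do rewrite /= mulrC.
Qed.

End tails.

Section transferred_tails.
Context {d : measure_display} {O : measurableType d} {R : realType}.
Variables (P : probability O R) (Z D : O -> R) (k : R).
Hypotheses (mD : measurable_fun setT D) (k_gt0 : 0 < k).
Hypothesis transfer : forall l g : R,
  (\int[P]_w (expR (l * Z w))%:E <= (expR g)%:E)%E ->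
  (\int[P]_w (expR (k * l * D w))%:E <= (expR (k * g))%:E)%E.

(** Chernoff's bound at the parameter [k * l]. *)
Lemma transferred_upper_tail (l g t : R) : 0 < l ->
  (\int[P]_w (expR (l * Z w))%:E <= (expR g)%:E)%E ->
  (P [set w | (t <= D w)%R] <= (expR (- (k * (l * t - g))))%:E)%E.
Proof.
move=> l0 /transfer/(upper_tail mD t (mulr_gt0 k_gt0 l0)).
by congr (_ <= (expR _)%:E)%E; ring.
Qed.

Lemma transferred_two_sided_tail (l g t : R) : 0 < l ->
  (\int[P]_w (expR (l * Z w))%:E <= (expR g)%:E)%E ->
  (\int[P]_w (expR (- l * Z w))%:E <= (expR g)%:E)%E ->
  (P [set w | (t <= `|D w|)%R] <= (2 * expR (- (k * (l * t - g))))%:E)%E.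
Proof.
move=> l0 mgf mgfN.
have mND : measurable_fun setT (fun w => - D w) by exact: measurableT_comp.
have lower : (P [set w | (t <= - D w)%R] <= (expR (- (k * (l * t - g))))%:E)%E.
  have := transfer mgfN; under eq_integral do rewrite mulrN mulNr -mulrN.
  move/(upper_tail mND t (mulr_gt0 k_gt0 l0)).
  by congr (_ <= (expR _)%:E)%E; ring.
apply: (@le_trans _ _ (P ([set w | t <= D w] `|` [set w | t <= - D w]))).
  apply: le_measure; rewrite ?inE.
  - by apply: measurable_superlevel; exact: measurableT_comp.
  - by apply: measurableU; exact: measurable_superlevel.
  - by move=> w /=; rewrite ler_normr => /orP.
apply: (le_trans (measureU2 _ _ _)); [exact: measurable_superlevel|exact: measurable_superlevel|].
by rewrite mulr_natl mulr2n EFinD leeD// (transferred_upper_tail _ l0).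
Qed.

(** The exponent is optimal at [l = t / v]. *)
Lemma gaussian_tails (v : R) : 0 < v ->
  (forall l : R, \int[P]_w (expR (l * Z w))%:E <= (expR (l ^+ 2 * v / 2))%:E)%E ->
  (forall t : R, 0 < t ->
    (P [set w | (t <= D w)%R] <= (expR (- (k * t ^+ 2 / (2 * v))))%:E)%E /\
    (P [set w | (t <= `|D w|)%R] <= (2 * expR (- (k * t ^+ 2 / (2 * v))))%:E)%E) /\
  (forall delta : R, 0 < delta -> delta < 1 ->
    ((1 - delta)%:E <=
     P [set w | (`|D w| <= Num.sqrt (2 * v * ln (2 / delta) / k))%R])%E).
Proof.
move=> v0 mgf.
have tail t : 0 < t ->
    (P [set w | (t <= D w)%R] <= (expR (- (k * t ^+ 2 / (2 * v))))%:E)%E /\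
    (P [set w | (t <= `|D w|)%R] <= (2 * expR (- (k * t ^+ 2 / (2 * v))))%:E)%E.
  move=> t0; have l0 : 0 < t / v by rewrite divr_gt0.
  have -> : k * t ^+ 2 / (2 * v) = k * (t / v * t - (t / v) ^+ 2 * v / 2).
    by field; rewrite gt_eqF.
  split; first exact: transferred_upper_tail.
  by apply: transferred_two_sided_tail => //; rewrite -sqrrN.
split=> // delta d0 d1; have [L0 L2] := ln_confidence d0 d1.
set L := ln _ in L0 L2 *.
have t20 : 0 < 2 * v * L / k by rewrite divr_gt0// !mulr_gt0.
apply: (confidence_of_tail mD); have [_] := tail (Num.sqrt (2 * v * L / k)) (eqbRL (sqrtr_gt0 _) t20).
move/le_trans; apply; rewrite -L2 sqr_sqrtr; last exact: ltW.
rewrite lee_fin le_eqVlt; apply/orP; left; apply/eqP; congr (_ * expR (- _)).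
by field; rewrite !gt_eqF.
Qed.

(** The Gaussian choice [l = t / v] is used while it is admissible, and the
    end point [l = alpha^-1] beyond, where [v / alpha <= t] bounds the quadratic
    term by half of the linear one. For the confidence statement, each of the
    two summands takes care of one argument of the minimum. *)
Lemma exponential_tails (v alpha : R) : 0 < v -> 0 < alpha ->
  (forall l : R, (`|l| <= alpha^-1)%R ->
    \int[P]_w (expR (l * Z w))%:E <= (expR (l ^+ 2 * v / 2))%:E)%E ->
  (forall t : R, 0 < t ->
    (P [set w | (t <= `|D w|)%R] <=
      (2 * expR (- (k / 2 * Num.min (t ^+ 2 / v) (t / alpha))))%:E)%E) /\
  (forall delta : R, 0 < delta -> delta < 1 ->
    ((1 - delta)%:E <=
     P [set w | (`|D w| <= Num.sqrt (2 * v * ln (2 / delta) / k) +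
                           2 * alpha * ln (2 / delta) / k)%R])%E).
Proof.
move=> v0 alpha0 mgf.
have tail t : 0 < t -> (P [set w | (t <= `|D w|)%R] <=
      (2 * expR (- (k / 2 * Num.min (t ^+ 2 / v) (t / alpha))))%:E)%E.
  move=> t0; pose l := Num.min (t / v) alpha^-1.
  have l0 : 0 < l by rewrite lt_min divr_gt0//= invr_gt0.
  have la : `|l| <= alpha^-1 by rewrite gtr0_norm// ge_min lexx orbT.
  have lN : `|- l| <= alpha^-1 by rewrite normrN.
  have := transferred_two_sided_tail t l0 (mgf l la).
  have := mgf (- l) lN; rewrite sqrrN => /[swap] /[apply] /le_trans; apply.
  rewrite lee_fin ler_pM2l// ler_expR lerN2 -mulrA ler_pM2l//.
  rewrite /l; have [tv|tv] := leP (t / v) alpha^-1.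
    rewrite (@le_trans _ _ (2^-1 * (t ^+ 2 / v)))//.
      by rewrite ler_pM2l ?invr_gt0// ge_min lexx.
    by rewrite le_eqVlt; apply/orP; left; apply/eqP; field; rewrite gt_eqF.
  rewrite (@le_trans _ _ (2^-1 * (t / alpha)))//.
    by rewrite ler_pM2l ?invr_gt0// ge_min lexx orbT.
  have va : alpha^-1 * v <= t by rewrite -ler_pdivlMr// ltW.
  have : alpha^-1 * (alpha^-1 * v) <= alpha^-1 * t by rewrite ler_pM2l ?invr_gt0.
  by rewrite expr2 [alpha^-1 * alpha^-1 * v]mulrC mulrA [v * _]mulrC; lra.
split=> // delta d0 d1; have [L0 L2] := ln_confidence d0 d1.
set L := ln _ in L0 L2 *.
set A := Num.sqrt _; set B := 2 * alpha * L / k.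
have A2 : A ^+ 2 = 2 * v * L / k by rewrite sqr_sqrtr// divr_ge0 ?mulr_ge0 ?ltW.
have A0 : 0 < A by rewrite sqrtr_gt0 divr_gt0 ?mulr_gt0.
have B0 : 0 < B by rewrite divr_gt0 ?mulr_gt0.
apply: (confidence_of_tail mD); have := tail (A + B) (addr_gt0 A0 B0).
move/le_trans; apply; rewrite -L2 lee_fin ler_pM2l// ler_expR lerN2.
rewrite -ler_pdivrMl ?divr_gt0// le_min; apply/andP; split.
  rewrite ler_pdivlMr//; apply: (@le_trans _ _ (A ^+ 2)).
    by rewrite A2 le_eqVlt; apply/orP; left; apply/eqP; field; rewrite gt_eqF.
  by rewrite lerXn2r ?nnegrE ?addr_ge0 ?lerDl// ltW.
rewrite ler_pdivlMr//; apply: (@le_trans _ _ B); last by rewrite lerDr ltW.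
by rewrite /B le_eqVlt; apply/orP; left; apply/eqP; field; rewrite gt_eqF.
Qed.

(** Letting [l] tend to infinity in the Chernoff bounds. *)
Lemma degenerate_tails (t : R) : 0 < t ->
  (forall l : R, \int[P]_w (expR (l * Z w))%:E <= 1)%E ->
  (P [set w | (t <= D w)%R] <= 0)%E /\ (P [set w | (t <= `|D w|)%R] <= 0)%E.
Proof.
move=> t0 mgf.
have vanish (x : \bar R) : (forall c : R, 0 < c -> (x <= (2 * expR (- c))%:E)%E) -> (x <= 0)%E.
  move=> xc; apply/lee_addgt0Pr => e e0; rewrite add0e.
  (* For c = 2 / e, 2 exp(- c) <= e because exp c >= c. *)
  apply: (le_trans (xc (2 / e) (divr_gt0 (ltr0Sn _ _) e0))); rewrite lee_fin.
  rewrite expRN ler_pdivrMr ?expR_gt0// -ler_pdivrMl//.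
  apply: le_trans (expR_ge1Dx _).
  by rewrite mulrC lerDr.
have mgf1 (l : R) : (\int[P]_w (expR (l * Z w))%:E <= (expR 0)%:E)%E by rewrite expR0.
(* The parameter l = c / (k t) makes the exponent of the bound equal to c. *)
have lc (c : R) : 0 < c -> 0 < c / (k * t) by move=> c0; rewrite divr_gt0 ?mulr_gt0.
have cE (c : R) : k * (c / (k * t) * t - 0) = c by field; rewrite !gt_eqF.
split; apply: vanish => c c0.
  have := transferred_upper_tail t (lc c c0) (mgf1 _); rewrite cE => /le_trans; apply.
  by rewrite lee_fin ler_peMl ?expR_ge0 ?ler1n.
have := transferred_two_sided_tail t (lc c c0) (mgf1 _) (mgf1 _).
by rewrite cE.
Qed.

(** Bennett's bound takes [l = ln (1 + u) / b] with [u = b t / s], the minimizer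
    of the exponent of [bennett_mgf]. Bernstein's takes
    [l = t / (s + b t / 3)], for which [1 - l b / 3 = s / (s + b t / 3)] and the
    quadratic term is half of the linear one. *)
Lemma bounded_tails (b s : R) : measurable_fun setT Z -> 0 < b -> 0 < s ->
  (forall w, `|Z w| <= b) -> (\int[P]_w (Z w)%:E = 0)%E ->
  (\int[P]_w (Z w ^+ 2)%:E = s%:E)%E ->
  (forall t : R, 0 < t ->
    (P [set w | (t <= D w)%R] <=
      (expR (- (k * s / b ^+ 2 * bennett (b * t / s))))%:E)%E /\
    (P [set w | (t <= `|D w|)%R] <=
      (2 * expR (- (k * t ^+ 2 / (2 * (s + b * t / 3)))))%:E)%E).
Proof.
move=> mZ b0 s0 Zb Z0 Z2 t t0; split.
  pose u := b * t / s; have u0 : 0 < u by rewrite divr_gt0 ?mulr_gt0.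
  have lnu : 0 < ln (1 + u) by apply: ln_gt0; rewrite ltrDl.
  have l0 : 0 < ln (1 + u) / b by rewrite divr_gt0.
  have := transferred_upper_tail t l0 (bennett_mgf _ mZ b0 Zb Z0 Z2).
  congr (_ <= (expR (- _))%:E)%E.
  rewrite gtr0_norm// divfK ?gt_eqF// lnK ?posrE ?addr_gt0// /bennett -/u.
  by rewrite /u; field; rewrite !gt_eqF.
have q0 : 0 < s + b * t / 3 by rewrite addr_gt0// divr_gt0// mulr_gt0.
pose l := t / (s + b * t / 3).
have l0 : 0 < l by rewrite divr_gt0.
have lb : `|l| * b < 3.
  by rewrite gtr0_norm// /l mulrAC ltr_pdivrMr// mulrDr; lra.
have mgf := bernstein_mgf mZ b0 Zb Z0 Z2.
have := transferred_two_sided_tail t l0 (mgf l lb).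
have := mgf (- l); rewrite normrN sqrrN => /(_ lb) /[swap] /[apply].
congr (_ <= (2 * expR (- _))%:E)%E.
have q3 : s * 3 + b * t != 0 by rewrite gt_eqF// addr_gt0 ?mulr_gt0.
rewrite gtr0_norm// /l; field.
by rewrite q3 [t * b]mulrC addrK gt_eqF ?mulr_gt0.
Qed.

End transferred_tails.

(** * Kernels at disjoint blocks of the two samples *)

Definition select (T : Type) (n m : nat) (s : 'I_m -> 'I_n) (x : n.-tuple T) :
  m.-tuple T := [tuple tnth x (s a) | a < m].

Lemma measurable_select {d : measure_display} {T : measurableType d} n m
    (s : 'I_m -> 'I_n) : measurable_fun [set: n.-tuple T] (select s).
Proof. by apply: measurable_tuple_of => a; exact: measurable_tnth. Qed.

Section selected_samples.
Context {d dX dY : measure_display} {O : measurableType d}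
  {TX : measurableType dX} {TY : measurableType dY} {R : realType}.
Variable P : probability O R.

Lemma measurable_sample {dT : measure_display} {T : measurableType dT} n
    (X : 'I_n -> {RV P >-> T}) : measurable_fun setT (sample X).
Proof. by apply: measurable_tuple_of => i. Qed.

Lemma select_sample {dT : measure_display} {T : measurableType dT} n m
    (X : 'I_n -> {RV P >-> T}) (s : 'I_m -> 'I_n) w :
  select s (sample X w) = [tuple X (s a) w | a < m].
Proof. by apply: eq_mktuple => a; rewrite tnth_mktuple. Qed.

Lemma select_sample_iid {dT : measure_display} {T : measurableType dT} n m
    (X : 'I_n -> {RV P >-> T}) (law : probability T R) (K : finType)
    (s : K -> 'I_m -> 'I_n) (s0 : 'I_m -> 'I_n) :
  iid_with_law P X law -> injective (fun p : K * 'I_m => s p.1 p.2) ->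
  injective s0 ->
  iid_as P (pushforward P (fun w => select s0 (sample X w)))
    (fun j w => select (s j) (sample X w)).
Proof.
move=> /iid_with_law_iid_as iidX inj_s inj_s0.
have mS : measurable_fun setT (fun w => select s0 (sample X w)).
  by apply: measurableT_comp; [exact: measurable_select|exact: measurable_sample].
pose mu : probability (m.-tuple T) R := distribution P (mfun_Sub (mem_set mS)).
have muE A : mu A = P ((fun w => select s0 (sample X w)) @^-1` A) by [].
rewrite (_ : (fun j w => _) = (fun j w => [tuple X (s j a) w | a < m])); last first.
  by apply/funext => j; apply/funext => w; rewrite select_sample.
apply: (@iid_as_blocks _ _ _ _ _ P m K law mu (fun p => X (s p.1 p.2))) => //.
  exact: (iid_as_inj inj_s iidX).
move=> B mB; rewrite muE.
rewrite (_ : (fun w => _) = (fun w => [tuple X (s0 a) w | a < m])); last first.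
  by apply/funext => w; rewrite select_sample.
by rewrite tuple_preimage_box; exact: (iid_as_inj inj_s0 iidX).
Qed.

Section two_samples.
Variables (n1 n2 m1 m2 : nat) (X : 'I_n1 -> {RV P >-> TX}) (Y : 'I_n2 -> {RV P >-> TY}).
Variables (lawX : probability TX R) (lawY : probability TY R).
Hypotheses (iidX : iid_with_law P X lawX) (iidY : iid_with_law P Y lawY).
Hypothesis indepXY : independent_pair P (sample X) (sample Y).
Variable h : m1.-tuple TX * m2.-tuple TY -> R.
Hypothesis h_meas : measurable_fun setT h.

Definition kernel_at (s : 'I_m1 -> 'I_n1) (t : 'I_m2 -> 'I_n2) (w : O) : R :=
  h (select s (sample X w), select t (sample Y w)).

Lemma measurable_kernel_at s t : measurable_fun setT (kernel_at s t).
Proof.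
apply: measurableT_comp => //; apply: measurable_fun_pair.
  by apply: measurableT_comp; [exact: measurable_select|exact: measurable_sample].
by apply: measurableT_comp; [exact: measurable_select|exact: measurable_sample].
Qed.

(** Distinct [j] read disjoint sets of variables in each sample, and within
    each [j] distinct positions read distinct variables. The common law is
    expressed through any injective choice [s0], [t0] of the positions. *)
Lemma kernel_at_iid (K : finType) (s : K -> 'I_m1 -> 'I_n1) (t : K -> 'I_m2 -> 'I_n2)
    (s0 : 'I_m1 -> 'I_n1) (t0 : 'I_m2 -> 'I_n2) :
  injective (fun p : K * 'I_m1 => s p.1 p.2) ->
  injective (fun p : K * 'I_m2 => t p.1 p.2) ->
  injective s0 -> injective t0 ->
  iid_as P (pushforward P (kernel_at s0 t0)) (fun j => kernel_at (s j) (t j)).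
Proof.
move=> inj_s inj_t inj_s0 inj_t0.
have mselX q : measurable_fun setT (fun w => select q (sample X w) : m1.-tuple TX).
  by apply: measurableT_comp; [exact: measurable_select|exact: measurable_sample].
have mselY q : measurable_fun setT (fun w => select q (sample Y w) : m2.-tuple TY).
  by apply: measurableT_comp; [exact: measurable_select|exact: measurable_sample].
pose mu := distribution P (mfun_Sub (mem_set (mselX s0))).
pose nu := distribution P (mfun_Sub (mem_set (mselY t0))).
have mXY := measurable_fun_pair (mselX s0) (mselY t0).
pose rho := distribution P (mfun_Sub (mem_set mXY)).
apply: (@iid_as_comp _ _ _ _ _ _ R P rho K
  (fun j w => (select (s j) (sample X w), select (t j) (sample Y w))) h h_meas).
apply: (@iid_as_pair _ _ _ _ _ _ _ P K mu nu rho) => //.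
- exact: (select_sample_iid iidX).
- exact: (select_sample_iid iidY).
- move=> A B mA mB.
  pose A' := [set x : n1.-tuple TX | forall j, A j (select (s j) x)].
  pose B' := [set y : n2.-tuple TY | forall j, B j (select (t j) y)].
  have mA' : measurable A'.
    apply: measurable_forall => j; rewrite -[X in measurable X]setTI.
    by apply: measurable_select => //; exact: mA.
  have mB' : measurable B'.
    apply: measurable_forall => j; rewrite -[X in measurable X]setTI.
    by apply: measurable_select => //; exact: mB.
  exact: (indepXY mA' mB').
- move=> A B mA mB.
  have := @indepXY (select s0 @^-1` A) (select t0 @^-1` B); apply.
    by rewrite -[X in measurable X]setTI; exact: measurable_select.
  by rewrite -[X in measurable X]setTI; exact: measurable_select.
Qed.

End two_samples.

End selected_samples.

(** * Convex domination and transfer of moment generating functions *)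

Lemma iid_as_single {d dS : measure_display} {O : measurableType d}
    {S : measurableType dS} {R : realType} (P : probability O R) (Z : O -> S) :
  measurable_fun setT Z -> iid_as P (pushforward P Z) (fun _ : 'I_1 => Z).
Proof.
move=> mZ A mA.
have mZA : measurable (Z @^-1` A ord0) by rewrite -[X in measurable X]setTI; exact: mZ.
rewrite big_ord1 /pushforward fineK ?fin_num_measure//; congr (P _).
by apply/seteqP; split=> w /= => [/(_ ord0)//|Aw i]; rewrite (ord1 i).
Qed.

(** [Z] alone is an i.i.d. family with one member, so it shares the law of any
    member of a family of its copies. *)
Lemma iid_as_integrable {d : measure_display} {O : measurableType d}
    {R : realType} (P : probability O R) (Z : O -> R) (I : finType) (V : I -> O -> R) i :
  P.-integrable setT (EFin \o Z) -> (forall j, measurable_fun setT (V j)) ->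
  iid_as P (pushforward P Z) V -> P.-integrable setT (EFin \o V i).
Proof.
move=> iZ mV iidV.
have mZ : measurable_fun setT Z by case/integrableP: iZ => /measurable_EFinP.
pose mu : probability R R := distribution P (mfun_Sub (mem_set mZ)).
have iid1 : iid_as P (pushforward P Z) (V \o (fun _ : 'I_1 => i)).
  by apply: (@iid_as_inj _ _ _ _ _ P mu) => //; move=> a b _; rewrite !ord1.
apply/integrableP; split; first exact/measurable_EFinP.
pose F (x : 1.-tuple R) := `|tnth x ord0|%:E.
have mF : measurable_fun [set: 1.-tuple R] F.
  by apply/measurable_EFinP; apply: measurableT_comp => //; exact: measurable_tnth.
have := iid_as_integral (fun=> mV i) (fun=> mZ) iid1 (iid_as_single P mZ) mF.
rewrite /F; under eq_integral do rewrite tnth_mktuple.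
under [in X in _ = X]eq_integral do rewrite tnth_mktuple.
by move=> /= ->; case/integrableP: iZ.
Qed.

Section domination.
Context {d dX dY : measure_display} {O : measurableType d}
  {TX : measurableType dX} {TY : measurableType dY} {R : realType}.
Variables (P : probability O R) (lawX : probability TX R) (lawY : probability TY R).
Variables (n1 n2 m1 m2 k : nat) (X : 'I_n1 -> {RV P >-> TX}) (Y : 'I_n2 -> {RV P >-> TY}).
Hypotheses (k_gt0 : (0 < k)%N) (k1 : (k * m1 <= n1)%N) (k2 : (k * m2 <= n2)%N).
Hypotheses (iidX : iid_with_law P X lawX) (iidY : iid_with_law P Y lawY).
Hypothesis indepXY : independent_pair P (sample X) (sample Y).
Variable h : m1.-tuple TX * m2.-tuple TY -> R.
Hypothesis h_meas : measurable_fun setT h.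
Variables (s0 : 'I_m1 -> 'I_n1) (t0 : 'I_m2 -> 'I_n2).
Hypotheses (inj_s0 : injective s0) (inj_t0 : injective t0).

Let Z := kernel_at X Y h s0 t0.
Hypothesis intZ : P.-integrable setT (EFin \o Z).

Let U w := two_sample_U h (sample X w) (sample Y w).

Let copy (p : {perm 'I_n1} * {perm 'I_n2}) (j : 'I_k) : O -> R :=
  kernel_at X Y h (fun a => tnth (arrange p.1 (block k1 j)) a)
                  (fun c => tnth (arrange p.2 (block k2 j)) c).

Let measurable_copy p j : measurable_fun setT (copy p j).
Proof. exact: measurable_kernel_at. Qed.

Let copy_iid p : iid_as P (pushforward P Z) (copy p).
Proof.
apply: (kernel_at_iid iidX iidY indepXY h_meas) => //.
  exact: arranged_blocks_inj.
exact: arranged_blocks_inj.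
Qed.

Let block_average p (m : R) w := k%:R^-1 * (\sum_(j < k) copy p j w) - m.

Let N := #|{: {perm 'I_n1} * {perm 'I_n2}}|.

Let N_gt0 : (0 < N)%N.
Proof. by apply/card_gt0P; exists (1%g, 1%g). Qed.

Let U_average m w : U w - m = N%:R^-1 * \sum_p block_average p m w.
Proof.
rewrite /U (two_sample_U_average k1 k2)// /block_average sumrB sumr_const mulrBr.
rewrite -(mulr_natl m) mulrA mulVf ?mul1r// pnatr_eq0 -lt0n.
exact: N_gt0.
Qed.

Let integrable_block_average p m : P.-integrable setT (EFin \o block_average p m).
Proof.
have icopy j : P.-integrable setT (EFin \o copy p j).
  exact: (iid_as_integrable j intZ (measurable_copy p) (copy_iid p)).
have isum : P.-integrable setT (EFin \o (fun w => \sum_(j < k) copy p j w)).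
  rewrite (_ : EFin \o _ = fun w => (\sum_(j < k) (copy p j w)%:E)%E).
    by apply: integrable_sum => // j _; exact: icopy.
  by apply/funext => w /=; rewrite sumEFin.
have := integrable_affine (- m) k%:R^-1 isum.
congr (_.-integrable _ _); apply/funext => w /=.
by rewrite /block_average addrC.
Qed.

Lemma measurable_U : measurable_fun setT U.
Proof.
rewrite (_ : U = fun w => N%:R^-1 * \sum_p block_average p 0 w).
  apply: measurable_funM => //; apply: measurable_sum => p.
  by case/integrableP: (integrable_block_average p 0) => /measurable_EFinP.
by apply/funext => w; rewrite -U_average subr0.
Qed.

(** The U-statistic is the average of the block averages, each of which has
    the law of the average of [k] copies on any probability space. *)
Lemma U_convex_domination (Phi : R -> R) (m : R) {dc : measure_display}
    {Oc : measurableType dc} (Pc : probability Oc R) (Zc : 'I_k -> Oc -> R) :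
  convex_function [set: R^o] Phi -> (forall j, measurable_fun setT (Zc j)) ->
  iid_as Pc (pushforward P Z) Zc ->
  (\int[P]_w (Phi (U w - m))%:E <=
   \int[Pc]_w (Phi (k%:R^-1 * (\sum_(j < k) Zc j w) - m))%:E)%E.
Proof.
move=> cvx mZc iidZc.
under eq_integral do rewrite U_average.
apply: (convex_average_expectation_le cvx N_gt0); first by move=> p; exact: integrable_block_average.
move=> p; pose F (x : k.-tuple R) := (Phi (k%:R^-1 * (\sum_(j < k) tnth x j) - m))%:E.
have mF : measurable_fun [set: k.-tuple R] F.
  apply/measurable_EFinP; apply: (measurableT_comp (convex_measurable cvx)).
  apply: measurable_funB => //; apply: measurable_funM => //.
  by apply: measurable_sum => j; exact: measurable_tnth.
have := iid_as_integral (measurable_copy p) mZc (copy_iid p) iidZc mF.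
rewrite /F; under eq_integral do under eq_bigr do rewrite tnth_mktuple.
by under [in X in _ = X]eq_integral do under eq_bigr do rewrite tnth_mktuple.
Qed.

(** Domination by the block average of the identity permutations for the convex
    function [x |-> e^(k l x)], which turns the average of the copies into a
    product of [k] independent factors. *)
Lemma U_mgf_transfer (m l g : R) :
  (\int[P]_w (expR (l * (Z w - m)))%:E <= (expR g)%:E)%E ->
  (\int[P]_w (expR (k%:R * l * (U w - m)))%:E <= (expR (k%:R * g))%:E)%E.
Proof.
move=> mgf; pose p : {perm 'I_n1} * {perm 'I_n2} := (1%g, 1%g).
have kN0 : k%:R != 0 :> R by rewrite pnatr_eq0 -lt0n.
apply: (le_trans (U_convex_domination m (convex_expRZ (k%:R * l)) (measurable_copy p) (copy_iid p))).
have mZ : measurable_fun setT Z by exact: measurable_kernel_at.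
pose mu : probability R R := distribution P (mfun_Sub (mem_set mZ)).
pose f (x : R) := expR (l * (x - m)).
have mf : measurable_fun setT f.
  by apply: measurableT_comp => //; apply: measurable_funM => //; exact: measurable_funB.
have fe : (\int[mu]_x (f x)%:E <= (expR g)%:E)%E.
  rewrite ge0_integral_distribution//; first exact/measurable_EFinP.
  by move=> x; rewrite lee_fin expR_ge0.
have := integral_prod_iid_as_le mf (fun x => expR_ge0 _) fe (measurable_copy p) (copy_iid p).
rewrite -expRM_natl; apply: le_trans.
rewrite le_eqVlt; apply/orP; left; apply/eqP; apply: eq_integral => w _.
congr (_%:E); rewrite /f -expR_sum -mulr_sumr sumrB sumr_const card_ord.
rewrite -(mulr_natl m); congr expR; field.
by [].
Qed.

End domination.

(** * The main theorem *)

Theorem theorem5p2 (R : realType) (d dX dY : measure_display)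
    (O : measurableType d) (TX : measurableType dX) (TY : measurableType dY)
    (P : probability O R) (lawX : probability TX R) (lawY : probability TY R)
    (m1 m2 n1 n2 : nat)
    (m1_gt0 : (1 <= m1)%N) (m2_gt0 : (1 <= m2)%N)
    (m1n1 : (m1 <= n1)%N) (m2n2 : (m2 <= n2)%N)
    (X : 'I_n1 -> {RV P >-> TX}) (Y : 'I_n2 -> {RV P >-> TY})
    (iidX : iid_with_law P X lawX) (iidY : iid_with_law P Y lawY)
    (indepXY : independent_pair P (sample X) (sample Y))
    (h : m1.-tuple TX * m2.-tuple TY -> R)
    (h_meas : measurable_fun [set: m1.-tuple TX * m2.-tuple TY] h) :
  let Z : O -> R := fun w =>
    h ([tuple X (widen_ord m1n1 a) w | a < m1],
       [tuple Y (widen_ord m2n2 c) w | c < m2]) in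
  forall (intZ : P.-integrable [set: O] (EFin \o Z)),
  let m_h : R := fine 'E_P[Z] in
  let U : O -> R := fun w => two_sample_U h (sample X w) (sample Y w) in
  let k : nat := minn (n1 %/ m1) (n2 %/ m2) in
  [/\ (* convex domination, for any k i.i.d. copies of Z on any space *)
      forall Phi : R -> R, convex_function [set: R^o] Phi ->
      forall (dc : measure_display) (Oc : measurableType dc)
        (Pc : probability Oc R) (Zc : 'I_k -> {RV Pc >-> R}),
        iid_with_law Pc Zc (pushforward P Z) ->
        ('E_P[fun w => Phi (U w - m_h)%R] <=
         'E_Pc[fun w => Phi (k%:R^-1 * (\sum_(i < k) Zc i w) - m_h)%R])%E,
      (* bounded range *)
      forall r a : R, 0 < r -> (forall z, a <= h z <= a + r) ->
        (forall t : R, 0 < t ->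
          (P [set w | (t <= U w - m_h)%R] <=
             (expR (- (2 * k%:R * t ^+ 2 / r ^+ 2)))%:E)%E /\
          (P [set w | (t <= `|U w - m_h|)%R] <=
             (2 * expR (- (2 * k%:R * t ^+ 2 / r ^+ 2)))%:E)%E) /\
        (forall delta : R, 0 < delta -> delta < 1 ->
          ((1 - delta)%:E <=
           P [set w | (`|U w - m_h| <=
                r * Num.sqrt (ln (2 / delta) / (2 * k%:R)))%R])%E),
      (* Bennett and Bernstein *)
      let sigma2 : R := fine 'V_P[Z] in
      forall b : R, sup_norm (fun z => h z - m_h) = b%:E ->
        (forall t : R, 0 < t ->
          (P [set w | (t <= U w - m_h)%R] <=
             (if sigma2 == 0 then 0
              else expR (- (k%:R * sigma2 / b ^+ 2 *
                            bennett (b * t / sigma2))))%:E)%E /\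
          (P [set w | (t <= `|U w - m_h|)%R] <=
             (if (sigma2 == 0) && (b == 0) then 0
              else 2 * expR (- (k%:R * t ^+ 2 /
                                (2 * (sigma2 + b * t / 3)))))%:E)%E) /\
        (forall delta : R, 0 < delta -> delta < 1 ->
          ((1 - delta)%:E <=
           P [set w | (`|U w - m_h| <=
                Num.sqrt (2 * sigma2 * ln (2 / delta) / k%:R) +
                2 * b * ln (2 / delta) / (3 * k%:R))%R])%E),
      (* sub-Gaussian *)
      forall nu : R, 0 < nu -> sub_gaussian P Z (nu ^+ 2) ->
        (forall t : R, 0 < t ->
          (P [set w | (t <= `|U w - m_h|)%R] <=
             (2 * expR (- (k%:R * t ^+ 2 / (2 * nu ^+ 2))))%:E)%E) /\
        (forall delta : R, 0 < delta -> delta < 1 ->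
          ((1 - delta)%:E <=
           P [set w | (`|U w - m_h| <=
                nu * Num.sqrt (2 * ln (2 / delta) / k%:R))%R])%E)
    & (* sub-exponential *)
      forall nu alpha : R, 0 < nu -> 0 < alpha ->
        sub_exponential P Z (nu ^+ 2) alpha ->
        (forall t : R, 0 < t ->
          (P [set w | (t <= `|U w - m_h|)%R] <=
             (2 * expR (- (k%:R / 2 *
                           Num.min (t ^+ 2 / nu ^+ 2) (t / alpha))))%:E)%E) /\
        (forall delta : R, 0 < delta -> delta < 1 ->
          ((1 - delta)%:E <=
           P [set w | (`|U w - m_h| <=
                nu * Num.sqrt (2 * ln (2 / delta) / k%:R) +
                2 * alpha * ln (2 / delta) / k%:R)%R])%E)].
Proof.
move=> Z intZ m_h U k.
have k_gt0 : (0 < k)%N by rewrite leq_min !divn_gt0// m1n1 m2n2.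
have k1 : (k * m1 <= n1)%N by rewrite (leq_trans _ (leq_divM n1 m1))// leq_mul2r geq_minl orbT.
have k2 : (k * m2 <= n2)%N by rewrite (leq_trans _ (leq_divM n2 m2))// leq_mul2r geq_minr orbT.
pose s0 := widen_ord m1n1; pose t0 := widen_ord m2n2.
have inj_s0 : injective s0 by move=> i j /(congr1 val)/= /val_inj.
have inj_t0 : injective t0 by move=> i j /(congr1 val)/= /val_inj.
have ZE : Z = kernel_at X Y h s0 t0.
  by apply/funext => w; rewrite /kernel_at !select_sample.
have mZ : measurable_fun setT Z by rewrite ZE; exact: measurable_kernel_at.
have intZ' : P.-integrable setT (EFin \o kernel_at X Y h s0 t0) by rewrite -ZE.
have mU : measurable_fun setT U.
  exact: (measurable_U k_gt0 k1 k2 iidX iidY indepXY h_meas inj_s0 inj_t0 intZ').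
pose D w := U w - m_h; pose Z0 w := Z w - m_h.
have mD : measurable_fun setT D by exact: measurable_funB.
have mZ0 : measurable_fun setT Z0 by exact: measurable_funB.
have kR0 : 0 < k%:R :> R by rewrite ltr0n.
have EZ : (\int[P]_w (Z w)%:E = m_h%:E)%E.
  by rewrite /m_h unlock fineK//; exact: (integrable_fin_num measurableT intZ).
have Z0_mean : (\int[P]_w (Z0 w)%:E = 0)%E.
  under eq_integral do rewrite /Z0 addrC -[X in _ + X]mul1r.
  by rewrite integral_affine// EZ mul1e -EFinD addNr.
have transfer (l g : R) : (\int[P]_w (expR (l * Z0 w))%:E <= (expR g)%:E)%E ->
    (\int[P]_w (expR (k%:R * l * D w))%:E <= (expR (k%:R * g))%:E)%E.
  rewrite /Z0 ZE => mgf.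
  exact: (U_mgf_transfer k_gt0 k1 k2 iidX iidY indepXY h_meas inj_s0 inj_t0 intZ' mgf).
have mmt (l : R) : 'M_P (Z \- cst m_h)%R l = (\int[P]_w (expR (l * Z0 w))%:E)%E.
  by rewrite /mmt_gen_fun unlock; apply: eq_integral => w _ /=; rewrite mulrC.
split.
- move=> Phi cvx dc Oc Pc Zc iidZc; rewrite unlock.
  apply: (U_convex_domination k_gt0 k1 k2 iidX iidY indepXY h_meas inj_s0 inj_t0 intZ' m_h cvx) => //.
  by rewrite -ZE; exact: iid_with_law_iid_as.
- move=> r a r0 har.
  (* A variable with values in an interval of length r is sub-Gaussian with
     variance proxy r^2 / 4. *)
  have v0 : 0 < r ^+ 2 / 4 by rewrite divr_gt0// exprn_gt0.
  have mgf l : (\int[P]_w (expR (l * Z0 w))%:E <= (expR (l ^+ 2 * (r ^+ 2 / 4) / 2))%:E)%E.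
    apply: (hoeffding_mgf (a := a - m_h)) => // w.
    have /andP[aZ Zr] : a <= Z w <= a + r by exact: har.
    by rewrite /Z0; apply/andP; split; lra.
  have [tails confidence] := gaussian_tails mD kR0 transfer v0 mgf; split.
    move=> t /tails; rewrite (_ : 2 * k%:R * t ^+ 2 / r ^+ 2 = k%:R * t ^+ 2 / (2 * (r ^+ 2 / 4)))//.
    by field; rewrite !gt_eqF.
  move=> delta d0 d1; have := confidence delta d0 d1.
  rewrite (_ : Num.sqrt _ = r * Num.sqrt (ln (2 / delta) / (2 * k%:R)))//.
  rewrite (_ : 2 * _ * _ / _ = r ^+ 2 * (ln (2 / delta) / (2 * k%:R))).
    by rewrite sqrtrM ?sqr_ge0// sqrtr_sqr gtr0_norm.
  by field; rewrite !gt_eqF.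
- move=> sigma2 b supb.
  have Zb z : `|h z - m_h| <= b.
    by rewrite -lee_fin -supb; apply: ereal_sup_ubound; exists z.
  have Z0b w : `|Z0 w| <= b by exact: Zb.
  have b0 : 0 <= b.
    by rewrite (le_trans (normr_ge0 _) (Zb ([tuple of nseq m1 point], [tuple of nseq m2 point]))).
  have Z02 : (\int[P]_w (Z0 w ^+ 2)%:E = sigma2%:E)%E.
    have VE : 'V_P[Z] = (\int[P]_w (Z0 w ^+ 2)%:E)%E.
      by rewrite /variance covariance.unlock /Z0 /m_h expectation.unlock; exact: eq_integral.
    rewrite /sigma2 VE fineK//; apply: (integrable_fin_num measurableT).
    apply: (@integrable_bounded _ _ _ P (fun w => Z0 w ^+ 2) (b ^+ 2)).
      exact: measurable_funX.
    by move=> w; rewrite normrX lerXn2r// nnegrE.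
  have sigma0 : 0 <= sigma2.
    by rewrite -lee_fin -Z02; apply: integral_ge0 => w _; rewrite lee_fin sqr_ge0.
  have [sigma2_0|sigma2_neq0] := eqVneq sigma2 0.
    have mgf1 l : (\int[P]_w (expR (l * Z0 w))%:E <= 1)%E.
      have [b_0|b_neq0] := eqVneq b 0.
        rewrite (eq_integral (cst 1%E)) => [|w _].
          by rewrite integral_cst//= probability_setT mule1.
        have := Z0b w; rewrite b_0 normr_le0 => /eqP ->.
        by rewrite mulr0 expR0.
      have b_gt0 : 0 < b by rewrite lt_neqAle eq_sym b_neq0.
      rewrite sigma2_0 in Z02.
      have := bennett_mgf l mZ0 b_gt0 Z0b Z0_mean Z02.
      by rewrite !mul0r expR0.
    split=> [t t_gt0|delta d0 d1].
      have [up two] := degenerate_tails mD kR0 transfer t_gt0 mgf1; split=> //.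
      apply: le_trans two _; rewrite lee_fin; by case: ifP.
    have [L0 _] := ln_confidence d0 d1.
    rewrite sigma2_0 mulr0 !mul0r sqrtr0 add0r.
    have [b_0|b_neq0] := eqVneq b 0.
      rewrite (_ : [set w | _] = setT).
        by rewrite probability_setT lee_fin gerBl ltW.
      apply/seteqP; split=> // w _ /=; rewrite b_0 mulr0 !mul0r.
      suff -> : U w = m_h by rewrite subrr normr0.
      have hE z : h z = m_h.
        by have := Zb z; rewrite b_0 normr_le0 subr_eq0 => /eqP.
      rewrite /U (two_sample_U_average k1 k2)// (eq_bigr (fun=> m_h)) => [|p _].
        rewrite sumr_const -(mulr_natl m_h) mulKf// pnatr_eq0 -lt0n.
        by apply/card_gt0P; exists (1%g, 1%g).
      rewrite (eq_bigr (fun=> m_h)) => [|j _]; last exact: hE.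
      by rewrite sumr_const card_ord -(mulr_natl m_h) mulKf// gt_eqF.
    have t_gt0 : 0 < 2 * b * ln (2 / delta) / (3 * k%:R).
      by rewrite divr_gt0// !mulr_gt0// lt_neqAle eq_sym b_neq0.
    apply: (confidence_of_tail mD).
    have [_ two] := degenerate_tails mD kR0 transfer t_gt0 mgf1.
    by apply: le_trans two _; rewrite lee_fin ltW.
  have sigma2_gt0 : 0 < sigma2 by rewrite lt_neqAle eq_sym sigma2_neq0.
  have b_gt0 : 0 < b.
    rewrite lt_neqAle b0 andbT eq_sym; apply: contra_neq sigma2_neq0 => b_0.
    suff : sigma2%:E = 0%E by case.
    rewrite -Z02; apply: integral0_eq => w _.
    by have := Z0b w; rewrite b_0 normr_le0 => /eqP ->; rewrite expr0n.
  have tails := bounded_tails mD kR0 transfer mZ0 b_gt0 sigma2_gt0 Z0b Z0_mean Z02.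
  split=> [t /tails[up two]|delta d0 d1]; first by split.
  have [L0 L2] := ln_confidence d0 d1.
  set L := ln _ in L0 L2 *.
  set A := Num.sqrt _; set B := 2 * b * L / (3 * k%:R).
  have A2 : A ^+ 2 = 2 * sigma2 * L / k%:R.
    by rewrite sqr_sqrtr// divr_ge0 ?mulr_ge0 ?ltW.
  have A0 : 0 <= A by exact: sqrtr_ge0.
  have B0 : 0 < B by rewrite divr_gt0 ?mulr_gt0.
  have AB0 : 0 < A + B by rewrite ltr_wpDl.
  apply: (confidence_of_tail mD); have [_] := tails _ AB0.
  move/le_trans; apply; rewrite -L2 lee_fin ler_pM2l// ler_expR lerN2.
  (* With A^2 = 2 sigma2 L / k and B = 2 b L / (3 k), the claim becomes
     A^2 + B (A + B) <= (A + B)^2. *)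
  rewrite ler_pdivlMr; last by rewrite mulr_gt0// addr_gt0// divr_gt0// mulr_gt0.
  have -> : L * (2 * (sigma2 + b * (A + B) / 3)) = k%:R * (A ^+ 2 + B * (A + B)).
    by rewrite A2 /B; field; rewrite gt_eqF.
  rewrite ler_pM2l// sqrrD.
  have : 0 <= A * B by rewrite mulr_ge0// ltW.
  nra.
- move=> nu nu0 sub.
  have v0 : 0 < nu ^+ 2 by rewrite exprn_gt0.
  have mgf l : (\int[P]_w (expR (l * Z0 w))%:E <= (expR (l ^+ 2 * nu ^+ 2 / 2))%:E)%E.
    by rewrite -mmt; exact: sub.
  have [tails confidence] := gaussian_tails mD kR0 transfer v0 mgf; split.
    by move=> t /tails[].
  move=> delta d0 d1; have := confidence delta d0 d1.
  rewrite (_ : 2 * nu ^+ 2 * _ / _ = nu ^+ 2 * (2 * ln (2 / delta) / k%:R)).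
    by rewrite sqrtrM ?sqr_ge0// sqrtr_sqr gtr0_norm.
  by field; rewrite !gt_eqF.
- move=> nu alpha nu0 alpha0 sub.
  have v0 : 0 < nu ^+ 2 by rewrite exprn_gt0.
  have mgf l : `|l| <= alpha^-1 ->
      (\int[P]_w (expR (l * Z0 w))%:E <= (expR (l ^+ 2 * nu ^+ 2 / 2))%:E)%E.
    by rewrite -mmt; exact: sub.
  have [tails confidence] := exponential_tails mD kR0 transfer v0 alpha0 mgf; split=> //.
  move=> delta d0 d1; have := confidence delta d0 d1.
  rewrite (_ : 2 * nu ^+ 2 * _ / _ = nu ^+ 2 * (2 * ln (2 / delta) / k%:R)).
    by rewrite sqrtrM ?sqr_ge0// sqrtr_sqr gtr0_norm.
  by field; rewrite !gt_eqF.
Qed.
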